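(* Let $\mathfrak L$ be a generalized Laguerre space over a ruled quadric. The structure of ''conic'' pencils, i.e. the structure $\langle\mathcal G,\mathcal K,\subset\rangle$ whose points are the projective lines of $\mathfrak L$ (the set $\mathcal G$) and whose blocks are the projective cones of $\mathfrak L$ (the set $\mathcal K$), with inclusion as incidence, is definable in the Grassmann space $\mathbf G_1(\mathfrak L)=\langle\wp_1,\wp_2,\subset\rangle$ of $1$-dimensional subspaces of $\mathfrak L$; that is, $\mathcal G$ is a definable subset of the sort $\wp_1$ and $\mathcal K$ is a definable subset of the sort $\wp_2$.
   Context: Setting. $\mathfrak P$ is a finite-dimensional Pappian non-Fanoian projective space (i.e. a projective space over a commutative field of characteristic $\neq 2$). $T,B$ are transversal (disjoint and together spanning $\mathfrak P$) nonempty subspaces of $\mathfrak P$, and $Q$ is a nondegenerate quadric in $B$ which is ruled (it contains a projective line). $S_0$ is the projective cone with vertex $T$ over $Q$, and $S=S_0\setminus T$ is the point set. Lines. $\mathcal L=\mathcal A\cup\mathcal G$ is the set of nonempty intersections with $S$ of projective lines contained in $S_0$: $\mathcal A$ (affine lines) consists of the sets $K\setminus T$ with $K\subset S_0$ a line meeting $T$ in exactly one point; $\mathcal G$ (projective lines) consists of the lines $K\subset S_0$ with $K\cap T=\emptyset$. Cycles. $\mathcal C$ is the set of nontrivial sections $S\cap A$, $A$ a plane of $\mathfrak P$, containing no line; these are exactly the (nondegenerate) conics lying on $S_0$. The generalized Laguerre space $\mathfrak L$ is the structure with points $S$, cycles $\mathcal C$, projective lines $\mathcal G$, affine lines $\mathcal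 A$, the natural parallelism of affine lines (same point on $T$), and incidence $\in$. $1$-dimensional subspaces: $\wp_1=\mathcal C\cup\mathcal L$. $2$-dimensional subspaces: $\wp_2$ is the union of the following seven classes of subsets of $S$: (i) projective planes: planes of $\mathfrak P$ contained in $S_0$ and disjoint from $T$; (ii) semiaffine planes: sets $E\setminus T$, $E\subset S_0$ a plane with $E\cap T$ a point; (iii) affine planes: sets $E\setminus T$, $E\subset S_0$ a plane with $E\cap T$ a line; (iv) affine cones: sets $S\cap V$, $V$ a $3$-dimensional projective subspace such that $V\cap S_0$ is a quadratic cone over a nondegenerate conic with vertex a point of $T$ (the vertex is thus removed); (v) projective cones: sets $S\cap V=S_0\cap V$, $V$ a $3$-dimensional projective subspace such that $V\cap S_0$ is a quadratic cone over a nondegenerate conic with vertex a point of $S$ (so $V\cap T=\emptyset$); (vi) Möbius planes: sets $S\cap V$, $V$ $3$-dimensional, which are nondegenerate nonruled quadrics (with points) of $V$; (vii) Minkowski planes: sets $S\cap V$, $V$ $3$-dimensional, which are nondegenerate ruled quadrics of $V$. (Unions of two distinct planes are not counted as members of $\wp_2$.) ''Definable'' means first-order definable, without parameters, in the two-sorted structure $\langle\wp_1,\wp_2,\subset\rangle$, where $\subset$ is the inclusion relation between elements of $\wp_1$ and elements of $\wp_2$. *)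

(* Defs.v *)
From mathcomp Require Import all_boot all_order all_algebra.
From mathcomp Require Import boolp classical_sets.

Set Implicit Arguments.
Unset Strict Implicit.
Unset Printing Implicit Defensive.

Import GRing.Theory.
Local Open Scope ring_scope.
Local Open Scope classical_set_scope.

(** * First-order definability in two-sorted incidence structures *)

Record incidence_structure := IncidenceStructure {
  ipoint : Type;
  iblock : Type;
  incident : ipoint -> iblock -> Prop
}.

(* First-order formulas with equality over the two-sorted signature
   <points, blocks, incidence>. The free point variables are the elements of
   [X] and the free block variables those of [Y]; a quantifier binds the
   variable [None]. There are no constants, hence no parameters. *)
Inductive formula (X Y : Type) : Type :=
| FEqPoint of X & X
| FEqBlock of Y & Y
| FInc of X & Y
| FNot of formula X Y
| FAnd of formula X Y & formula X Y
| FExPoint of formula (option X) Y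
| FExBlock of formula X (option Y).

Definition extend_env (X D : Type) (e : X -> D) (d : D) (o : option X) : D :=
  if o is Some x then e x else d.

Fixpoint sat (M : incidence_structure) (X Y : Type)
    (e : X -> ipoint M) (f : Y -> iblock M) (phi : formula X Y) : Prop :=
  match phi in formula _ _
    return (X -> ipoint M) -> (Y -> iblock M) -> Prop with
  | FEqPoint x x' => fun e _ => e x = e x'
  | FEqBlock y y' => fun _ f => f y = f y'
  | FInc x y => fun e f => incident (e x) (f y)
  | FNot psi => fun e f => ~ sat e f psi
  | FAnd psi chi => fun e f => sat e f psi /\ sat e f chi
  | FExPoint psi => fun e f => exists d, sat (extend_env e d) f psi
  | FExBlock psi => fun e f => exists d, sat e (extend_env f d) psi
  end e f.

Definition definable_points (M : incidence_structure) (D : set (ipoint M)) :=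
  exists phi : formula unit void, forall d : ipoint M,
    D d <-> sat (fun _ => d) (of_void _) phi.

Definition definable_blocks (M : incidence_structure) (D : set (iblock M)) :=
  exists phi : formula void unit, forall d : iblock M,
    D d <-> sat (of_void _) (fun _ => d) phi.

(** * Projective geometry of a vector space *)

(* The projective space over [V]: projective subspaces are vector subspaces,
   so points, lines, planes and solids have [\dim] equal to 1, 2, 3 and 4. *)
Definition proj_point (F : fieldType) (V : vectType F) : Type :=
  {p : {vspace V} | \dim p == 1%N}.

Definition points_of (F : fieldType) (V : vectType F) (U : {vspace V}) :
    set (proj_point V) :=
  [set p | (val p <= U)%VS].

(* Quadrics are zero sets of quadratic forms, here given by symmetric bilinear
   forms: the characteristic is meant to be different from 2. The form is
   defined on [V], but only its restriction to [U] matters. *)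
Definition nondegenerate_quadric (F : fieldType) (V : vectType F)
    (U : {vspace V}) (X : set (proj_point V)) : Prop :=
  exists beta : {symmetric V},
    (forall u, u \in U -> (forall v, v \in U -> beta u v = 0) -> u = 0) /\
    X = [set p | (val p <= U)%VS /\ forall u, u \in val p -> beta u u = 0].

Definition ruled (F : fieldType) (V : vectType F)
    (X : set (proj_point V)) : Prop :=
  exists K : {vspace V}, \dim K = 2%N /\ points_of K `<=` X.

Definition cone (F : fieldType) (V : vectType F)
    (W : {vspace V}) (X : set (proj_point V)) : set (proj_point V) :=
  [set p | exists t x, [/\ points_of W t, X x & (val p <= val t + val x)%VS]].

Definition quadratic_cone (F : fieldType) (V : vectType F)
    (U : {vspace V}) (v : proj_point V) (X : set (proj_point V)) : Prop :=
  exists (A : {vspace V}) (C : set (proj_point V)),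
    [/\ \dim A = 3%N, (A <= U)%VS, ~ points_of A v & points_of U v] /\
    [/\ nondegenerate_quadric A C, C !=set0 & X = cone (val v) C].

(** * Generalized Laguerre spaces *)

Section Laguerre.
Context (F : fieldType) (V : vectType F).
Context (T : {vspace V}) (Q : set (proj_point V)).

Definition lag_cone : set (proj_point V) := cone T Q.

Definition lag_points : set (proj_point V) := lag_cone `\` points_of T.

Definition affine_lines : set (set (proj_point V)) :=
  [set X | exists K : {vspace V}, [/\ \dim K = 2%N, points_of K `<=` lag_cone,
     \dim (K :&: T) = 1%N & X = points_of K `\` points_of T]].

Definition projective_lines : set (set (proj_point V)) :=
  [set X | exists K : {vspace V}, [/\ \dim K = 2%N, points_of K `<=` lag_cone,
     (K :&: T)%VS = 0%VS & X = points_of K]].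

Definition lag_lines := affine_lines `|` projective_lines.

(* A section is trivial when it is empty or a single point. *)
Definition cycles : set (set (proj_point V)) :=
  [set X | exists A : {vspace V}, [/\ \dim A = 3%N,
     X = lag_points `&` points_of A,
     exists p q, [/\ X p, X q & p <> q] &
     forall L, lag_lines L -> ~ L `<=` X]].

Definition wp1 : set (set (proj_point V)) := cycles `|` lag_lines.

Definition projective_planes : set (set (proj_point V)) :=
  [set X | exists E : {vspace V}, [/\ \dim E = 3%N, points_of E `<=` lag_cone,
     (E :&: T)%VS = 0%VS & X = points_of E]].

Definition semiaffine_planes : set (set (proj_point V)) :=
  [set X | exists E : {vspace V}, [/\ \dim E = 3%N, points_of E `<=` lag_cone,
     \dim (E :&: T) = 1%N & X = points_of E `\` points_of T]].

Definition affine_planes : set (set (proj_point V)) :=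
  [set X | exists E : {vspace V}, [/\ \dim E = 3%N, points_of E `<=` lag_cone,
     \dim (E :&: T) = 2%N & X = points_of E `\` points_of T]].

Definition affine_cones : set (set (proj_point V)) :=
  [set X | exists (U : {vspace V}) (v : proj_point V), [/\ \dim U = 4%N,
     points_of T v, quadratic_cone U v (points_of U `&` lag_cone) &
     X = lag_points `&` points_of U]].

Definition projective_cones : set (set (proj_point V)) :=
  [set X | exists (U : {vspace V}) (v : proj_point V), [/\ \dim U = 4%N,
     lag_points v, quadratic_cone U v (points_of U `&` lag_cone) &
     X = lag_points `&` points_of U]].

Definition moebius_planes : set (set (proj_point V)) :=
  [set X | exists U : {vspace V}, \dim U = 4%N /\
     X = lag_points `&` points_of U /\
     [/\ nondegenerate_quadric U X, X !=set0 & ~ ruled X]].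

Definition minkowski_planes : set (set (proj_point V)) :=
  [set X | exists U : {vspace V}, \dim U = 4%N /\
     X = lag_points `&` points_of U /\
     nondegenerate_quadric U X /\ ruled X].

Definition wp2 : set (set (proj_point V)) :=
  projective_planes `|` semiaffine_planes `|` affine_planes `|`
  affine_cones `|` projective_cones `|` moebius_planes `|` minkowski_planes.

Definition grassmann1 : incidence_structure :=
  @IncidenceStructure
    {X : set (proj_point V) | wp1 X} {Y : set (proj_point V) | wp2 Y}
    (fun X Y => sval X `<=` sval Y).

End Laguerre.

(* Main.v *)
(** Two distinct one-dimensional subspaces are called adjacent when at least two
    members of [wp2] contain both. The spans of two such members are distinct
    and of dimension at most 4, so adjacent subspaces span a plane; this plane
    is not contained in the cone, and the subspaces are two lines in it, meeting
    in a point [v] (which lies in [T] when the lines are affine). Conversely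
    such lines [<v, x1>], [<v, x2>] are adjacent. If [v] is not in [T], complete [v]
    to a hyperbolic pair [v], [z] orthogonal to [x1], [x2]; then
    [<v, x1, x2, z>] and [<v, x1, x2, z + t>] with [0 <> t] in [T] give two
    Minkowski planes. If [v] is in [T], take the affine cones
    [<v, x1, x2, w_i>] with [w_1], [w_2] orthogonal nonsingular vectors of
    [<x1, x2>^perp]. Hence all lines in a cone are pairwise adjacent, while in a
    Minkowski plane a line is adjacent to two skew, nonadjacent, ones. So the
    Minkowski planes are the blocks containing a line adjacent to two distinct
    nonadjacent ones; projective lines are those contained in such a block, and
    projective cones are the other blocks containing adjacent projective
    lines. *)
Require Import Defs.
From HB Require Import structures.
From mathcomp Require Import all_boot all_order all_algebra.
From mathcomp Require Import boolp classical_sets.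
From mathcomp Require Import ring.

Set Implicit Arguments.
Unset Strict Implicit.
Unset Printing Implicit Defensive.

Import GRing.Theory.
Local Open Scope ring_scope.
Local Open Scope classical_set_scope.

(** * Lines and planes in a vector space *)

Section VectorSpaces.
Context {F : fieldType} {V : vectType F}.
Implicit Types (u v w x : V) (U W K : {vspace V}).

Lemma memv_addlineP w U u :
  w \in (U + <[u]>)%VS -> exists2 k, k \in U & exists c, w = k + c *: u.
Proof. by case/memv_addP=> k kU [_ /vlineP[c ->] ->]; exists k => //; exists c. Qed.

Lemma memv_addlineI U u k c : k \in U -> k + c *: u \in (U + <[u]>)%VS.
Proof. by move=> kU; apply: memv_add => //; apply: memvZ; apply: memv_line. Qed.

Lemma memv_addline U u : u \in (U + <[u]>)%VS.
Proof. by rewrite -[u in X in X \in _]add0r memv_add ?mem0v ?memv_line. Qed.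

Lemma memv_line2P w u v :
  w \in (<[u]> + <[v]>)%VS -> exists a c, w = a *: u + c *: v.
Proof. by case/memv_addlineP=> _ /vlineP[a ->] [c ->]; exists a, c. Qed.

Lemma memv_line2I u v a c : a *: u + c *: v \in (<[u]> + <[v]>)%VS.
Proof. by apply: memv_addlineI; apply: memvZ; apply: memv_line. Qed.

Lemma memv_line2l u v : u \in (<[u]> + <[v]>)%VS.
Proof. by have := memv_line2I u v 1 0; rewrite scale1r scale0r addr0. Qed.

Lemma addline_sub U W u : (W <= U)%VS -> u \in U -> (W + <[u]> <= U)%VS.
Proof. by move=> WU uU; rewrite subv_add WU -memvE. Qed.

Lemma dim_addline U u : u \notin U -> \dim (U + <[u]>) = (\dim U).+1.
Proof.
move=> uU; have u0 : u != 0 by apply: contraNneq uU => ->; apply: mem0v.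
rewrite dimv_disjoint_sum ?dim_vline ?u0 ?addn1 //.
apply/eqP; rewrite -subv0; apply/subvP=> w; rewrite memv_cap => /andP[wU].
case/vlineP=> c wE; rewrite memv0; case: (eqVneq c 0) => [c0|c0].
  by rewrite wE c0 scale0r.
case/negP: uU; have -> : u = c^-1 *: w by rewrite wE scalerA mulVf // scale1r.
exact: memvZ.
Qed.

Lemma dim_line2 u v : u != 0 -> v \notin <[u]>%VS -> \dim (<[u]> + <[v]>) = 2%N.
Proof. by move=> u0 vu; rewrite dim_addline // dim_vline u0. Qed.

Lemma ex_notin U K : (\dim U < \dim K)%N -> exists2 x, x \in K & x \notin U.
Proof.
move=> UK; apply/subvPn; apply: contraTN UK => /dimvS.
by rewrite -leqNgt.
Qed.

Lemma ex_neq0 K : (0 < \dim K)%N -> exists2 x, x \in K & x != 0.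
Proof.
move=> K0; have [|x xK] := @ex_notin 0%VS K; first by rewrite dimv0.
by rewrite memv0; exists x.
Qed.

Lemma dim2_gen K v : \dim K = 2%N -> v \in K -> v != 0 ->
  exists2 x, x \notin <[v]>%VS & K = (<[v]> + <[x]>)%VS.
Proof.
move=> K2 vK v0; have [|x xK xv] := @ex_notin <[v]>%VS K; first by rewrite dim_vline v0 K2.
exists x => //; apply/eqP; rewrite eq_sym eqEdim addline_sub //=.
by rewrite dim_line2 // K2.
Qed.

Lemma sub_dim_eq U W : (U <= W)%VS -> (\dim W <= \dim U)%N -> U = W.
Proof. by move=> UW dWU; apply/eqP; rewrite eqEdim UW dWU. Qed.

Lemma dim_cap_ge K U W : (K <= W)%VS -> (U <= W)%VS ->
  (\dim K + \dim U <= \dim W + \dim (K :&: U))%N.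
Proof.
by move=> KW UW; rewrite -dimv_sum_cap leq_add2r dimvS // subv_add KW UW.
Qed.

End VectorSpaces.

(** * Symmetric bilinear forms *)

Section Forms.
Context {F : fieldType} {V : vectType F}.

Section OneForm.
Context (b : {symmetric V}).
Implicit Types (u v w x : V) (U W K : {vspace V}).

Lemma formC u v : b u v = b v u.
Proof. by have := hermC b u v; rewrite expr0 mul1r. Qed.

Lemma formDl u v w : b (u + v) w = b u w + b v w.
Proof. exact: linearDl. Qed.

Lemma formDr u v w : b w (u + v) = b w u + b w v.
Proof. by rewrite !(formC w) formDl. Qed.

Lemma formZl c u v : b (c *: u) v = c * b u v.
Proof. exact: linearZl_LR. Qed.

Lemma formZr c u v : b u (c *: v) = c * b u v.
Proof. by rewrite !(formC u) formZl. Qed.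

Lemma formNl u v : b (- u) v = - b u v.
Proof. by rewrite -scaleN1r formZl mulN1r. Qed.

Lemma formNr u v : b u (- v) = - b u v.
Proof. by rewrite !(formC u) formNl. Qed.

Lemma form0l v : b 0 v = 0.
Proof. by rewrite -[0 in X in b X](scale0r 0) formZl mul0r. Qed.

Lemma form0r v : b v 0 = 0.
Proof. by rewrite formC form0l. Qed.

Definition formE := (formDl, formDr, formZl, formZr, formNl, formNr, form0l, form0r).

Definition totally_singular U := forall u, u \in U -> b u u = 0.

Definition nondegenerate_on U :=
  forall u, u \in U -> (forall v, v \in U -> b u v = 0) -> u = 0.

Lemma totally_singularS U W :
  (W <= U)%VS -> totally_singular U -> totally_singular W.
Proof. by move=> WU sU u /(subvP WU) /sU. Qed.

Hypothesis two_neq0 : 2%:R != 0 :> F.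

(** Expanding the form at [u + v] leaves twice [b u v], which is where the characteristic enters. *)
Lemma polarization u v : b u u = 0 -> b v v = 0 -> b (u + v) (u + v) = 0 -> b u v = 0.
Proof.
rewrite !formE (formC v u) => -> ->; rewrite add0r addr0 -mulr2n -mulr_natl.
by move/eqP; rewrite mulf_eq0 (negPf two_neq0) => /eqP.
Qed.

Lemma totally_singular_form U u v :
  totally_singular U -> u \in U -> v \in U -> b u v = 0.
Proof. by move=> sU uU vU; apply: polarization; apply: sU => //; apply: rpredD. Qed.

Lemma totally_singular_line u : b u u = 0 -> totally_singular <[u]>%VS.
Proof. by move=> uu w /vlineP[c ->]; rewrite !formE uu !mulr0. Qed.

Lemma totally_singular_addline U u : totally_singular U -> b u u = 0 ->
  (forall w, w \in U -> b w u = 0) -> totally_singular (U + <[u]>)%VS.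
Proof.
move=> sU uu Uu w /memv_addlineP[k kU [c ->]].
by rewrite !formE (formC u k) uu (Uu _ kU) sU // !mulr0 !addr0.
Qed.

Lemma totally_singular_line2 u v : b u u = 0 -> b v v = 0 -> b u v = 0 ->
  totally_singular (<[u]> + <[v]>)%VS.
Proof.
move=> uu vv uv; apply: totally_singular_addline => //.
  exact: totally_singular_line.
by move=> w /vlineP[c ->]; rewrite !formE uv mulr0.
Qed.

(* The form embeds a totally singular [K] in the dual of a complement. *)
Lemma totally_singular_dim U K : nondegenerate_on U -> totally_singular K ->
  (K <= U)%VS -> (\dim K + \dim K <= \dim U)%N.
Proof.
move=> nU sK KU; pose W := (U :\: K)%VS.
pose f u := \row_j b u (vbasis W)`_j : 'rV[F]_(\dim W).
have linf : linear f.
  by move=> c u v; apply/rowP=> j; rewrite !mxE !formE.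
pose fl : {linear V -> 'rV[F]_(\dim W)} := HB.pack f (GRing.isLinear.Build _ _ _ _ f linf).
(* A vector of [K] is orthogonal to [K] by polarization; if it is orthogonal to [W] as well, it is
   orthogonal to all of [U] and vanishes. So the map is injective on [K]. *)
have dimK : \dim (linfun fl @: K) = \dim K.
  apply: limg_dim_eq; apply/eqP; rewrite -subv0; apply/subvP=> u.
  rewrite memv_cap memv0 memv_ker lfunE /= => /andP[uK /eqP fu0].
  apply/eqP; apply: nU; first exact: (subvP KU).
  move=> v vU; have : v \in (K + W)%VS.
    rewrite /W addvC; apply: (subvP _ v vU).
    by rewrite -[X in (X <= _)%VS](addv_diff_cap U K) addvS ?capvSr.
  case/memv_addP=> k kK [w wW ->]; rewrite formDr (totally_singular_form sK uK kK) add0r.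
  rewrite (coord_vbasis wW) linear_sumr big1 // => j _.
  apply: etrans (formZr _ _ _) _; have := congr1 (fun r : 'rV[F]_(\dim W) => r ord0 j) fu0.
  by rewrite /f !mxE => ->; rewrite mulr0.
have : (\dim (linfun fl @: K) <= \dim W)%N.
  by apply: leq_trans (dimvS (subvf _)) _; rewrite dimvf /dim /= mul1n.
by rewrite dimK -(dimv_cap_compl U K) (capv_idPr KU) leq_add2l.
Qed.

Lemma hyperbolic_partner U u : nondegenerate_on U -> u \in U -> u != 0 ->
  b u u = 0 -> exists w, [/\ w \in U, b w w = 0 & b u w = 1].
Proof.
move=> nU uU u0 uu.
have [w wU uw] : exists2 w, w \in U & b u w != 0.
  apply: contrapT => nw; case/negP: u0; apply/eqP/nU => // v vU.
  by apply: contrapT => /eqP uv; apply: nw; exists v.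
have [w1 w1U uw1] : exists2 w1, w1 \in U & b u w1 = 1.
  by exists ((b u w)^-1 *: w); rewrite ?rpredZ // formZr mulVf.
(* Moving [w1] along the singular vector [u] keeps its product with [u] and changes its square by
   twice the coefficient. *)
exists (w1 - (b w1 w1 / 2%:R) *: u); split.
- by rewrite rpredB ?rpredZ.
- by rewrite !formE (formC w1 u) uu uw1; field.
- by rewrite !formE uu uw1; ring.
Qed.

End OneForm.
End Forms.

(** * Points and the vectors that span them *)

Section Points.
Context {F : fieldType} {V : vectType F}.
Implicit Types (u v w x : V) (U W K : {vspace V}) (p : proj_point V).

Lemma dim_point p : \dim (val p) = 1%N.
Proof. exact/eqP/(valP p). Qed.

Lemma point_gen p : exists2 u, u != 0 & val p = <[u]>%VS.
Proof.
have [|u up u0] := @ex_neq0 _ _ (val p); first by rewrite dim_point.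
exists u => //; apply/esym/sub_dim_eq; first by rewrite -memvE.
by rewrite dim_point dim_vline u0.
Qed.

Lemma ex_point u : u != 0 -> exists p, val p = <[u]>%VS.
Proof.
move=> u0; have du : \dim <[u]> == 1%N by rewrite dim_vline u0.
by exists (exist (fun W : {vspace V} => \dim W == 1%N) <[u]>%VS du).
Qed.

Lemma points_of_line p u U : val p = <[u]>%VS -> points_of U p <-> u \in U.
Proof. by rewrite /points_of /= => ->; rewrite -memvE. Qed.

Lemma points_of_point p q : points_of (val p) q -> q = p.
Proof. by move=> qp; apply/val_inj/sub_dim_eq; rewrite ?dim_point. Qed.

Lemma eq_sval (T : Type) (P : T -> Prop) (s t : {x | P x}) : sval s = sval t <-> s = t.
Proof. by case: s t => [s sP] [t tP]; split=> [/= st|[]//]; apply: eq_exist. Qed.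

End Points.

(** * Sections of the cone over a quadric *)

Section LaguerreSpace.
Context {F : fieldType} {V : vectType F}.
Implicit Types (u v w x : V) (U W K A E : {vspace V}) (p : proj_point V).
Implicit Types (X Y : set (proj_point V)).
Context (T : {vspace V}) (Q : set (proj_point V)) (b : {symmetric V}).

Hypothesis two_neq0 : 2%:R != 0 :> F.
(** From here on the cone is known only as the zero set of a quadratic form with radical exactly
    [T]. The bound on the codimension of [T] is what a ruled quadric contributes. *)
Hypothesis lag_coneE : forall p, lag_cone T Q p <-> totally_singular b (val p).
Hypothesis radicalP : forall u, u \in T <-> forall v, b u v = 0.
Hypothesis radical_neq0 : T != 0%VS.
Hypothesis codim_radical : (\dim T + 4 <= \dim {:V})%N.

(** Vectors outside [T] are nonzero, so these are precisely the vectors that span points of the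
    space. *)
Definition lag_vector u := u \notin T /\ b u u = 0.

(** Lines, cycles and all seven classes of [wp2] take this one form, whether or not [U] meets [T];
    incidence then becomes inclusion of subspaces. *)
Definition section_by U := lag_points T Q `&` points_of U.

Lemma form_radicall u v : u \in T -> b u v = 0.
Proof. by move/radicalP. Qed.

Lemma form_radicalr u v : v \in T -> b u v = 0.
Proof. by rewrite formC => /form_radicall. Qed.

Lemma notin_radical u v : b u v != 0 -> u \notin T.
Proof. by apply: contraNN => /form_radicall ->. Qed.

Lemma totally_singular_lineE u : totally_singular b <[u]>%VS <-> b u u = 0.
Proof. by split=> [s|]; [apply: s; apply: memv_line|exact: totally_singular_line]. Qed.

Lemma lag_pointE p u : val p = <[u]>%VS -> lag_points T Q p <-> lag_vector u.
Proof.
move=> pu; split=> [[/lag_coneE]|[uT uu]].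
  by rewrite pu => /totally_singular_lineE uu /(points_of_line _ pu)/negP.
split; first by apply/lag_coneE; rewrite pu; apply/totally_singular_lineE.
by move/(points_of_line _ pu); apply/negP.
Qed.

Lemma lag_vector_neq0 u : lag_vector u -> u != 0.
Proof. by case=> uT _; apply: contraNneq uT => ->; apply: mem0v. Qed.

Lemma section_byE U p u : val p = <[u]>%VS ->
  section_by U p <-> lag_vector u /\ u \in U.
Proof. by move=> pu; rewrite /section_by /= (lag_pointE pu) (points_of_line _ pu). Qed.

Lemma section_by_subP U W : section_by U `<=` section_by W <->
  forall u, u \in U -> lag_vector u -> u \in W.
Proof.
split=> [sub u uU lu|sub p].
  have [p pu] := ex_point (lag_vector_neq0 lu).
  by have /(section_byE _ pu)[] := sub p (proj2 (section_byE _ pu) (conj lu uU)).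
have [u _ pu] := point_gen p.
by move/(section_byE _ pu) => [lu uU]; apply/(section_byE _ pu); split=> //; apply: sub.
Qed.

Lemma sub_section_by U W : (U <= W)%VS -> section_by U `<=` section_by W.
Proof. by move=> /subvP UW; apply/section_by_subP => u /UW. Qed.

Lemma points_of_lag_coneP K : points_of K `<=` lag_cone T Q <-> totally_singular b K.
Proof.
split=> [sub u uK|sK p pK]; last first.
  by apply/lag_coneE; apply: totally_singularS sK.
have [->|u0] := eqVneq u 0; first by rewrite form0l.
have [p pu] := ex_point u0; apply/totally_singular_lineE; rewrite -pu.
by apply/lag_coneE/sub/(points_of_line _ pu).
Qed.

Lemma section_by_affine K : totally_singular b K ->
  points_of K `\` points_of T = section_by K.
Proof.
move=> sK; apply/seteqP; split=> p [].
  by move=> pK pT; split=> //; split=> //; exact: (proj2 (points_of_lag_coneP K)).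
by case=> _ pT pK.
Qed.

Lemma section_by_projective K : totally_singular b K -> (K :&: T)%VS = 0%VS ->
  points_of K = section_by K.
Proof.
move=> sK KT; rewrite -section_by_affine //; apply/seteqP; split=> p; last by case.
move=> pK; split=> // pT; have : (val p <= K :&: T)%VS by rewrite subv_cap pK.
by rewrite KT => /dimvS; rewrite dim_point dimv0.
Qed.

(** * Lines and cycles as sections *)

(** Covers both kinds of lines: [K] meets [T] in dimension 1 for an affine line and in dimension 0
    for a projective one. *)
Definition lag_line_space K := [/\ \dim K = 2%N, totally_singular b K & ~~ (K <= T)%VS].

Lemma lag_linesP X : lag_lines T Q X <-> exists2 K, lag_line_space K & X = section_by K.
Proof.
split=> [[] [K [K2 /points_of_lag_coneP sK KT ->]]|[K [K2 sK KT] ->]].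
- exists K; last exact: section_by_affine.
  by split=> //; apply/negP => /capv_idPl KE; rewrite KE K2 in KT.
- exists K; last exact: section_by_projective.
  by split=> //; apply/negP => /capv_idPl KE; rewrite -KE KT dimv0 in K2.
have sub : points_of K `<=` lag_cone T Q by apply/points_of_lag_coneP.
have : (\dim (K :&: T) < 2)%N.
  rewrite ltnNge -K2; apply: contra KT => KT.
  by rewrite -(sub_dim_eq (capvSl K T) KT) capvSr.
case dKT : (\dim (K :&: T)) => [|[|//]] _.
  have KT0 : (K :&: T)%VS = 0%VS by apply/eqP; rewrite -dimv_eq0 dKT.
  by right; exists K; split=> //; rewrite section_by_projective.
by left; exists K; split=> //; rewrite section_by_affine.
Qed.

Lemma projective_linesP X : projective_lines T Q X <->
  exists K, [/\ lag_line_space K, (K :&: T)%VS = 0%VS & X = section_by K].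
Proof.
split=> [[K [K2 /points_of_lag_coneP sK KT ->]]|[K [[K2 sK _] KT ->]]].
  exists K; split=> //; last exact: section_by_projective.
  by split=> //; apply/negP => /capv_idPl KE; rewrite -KE KT dimv0 in K2.
by exists K; split; rewrite -?section_by_projective //; apply/points_of_lag_coneP.
Qed.

(** Expresses that [U] is generated by the points of its section, and can therefore be recovered
    from that section. *)
Definition spanned U := forall W,
  (forall u, u \in U -> lag_vector u -> u \in W) -> (U <= W)%VS.

(** Only the vectors [w] of [K] in [T] need care. With [u] in [K] outside [T], the sum [u + w] is
    again outside [T], and [w] is the difference of [u + w] and [u]. *)
Lemma totally_singular_spanned K : totally_singular b K -> ~~ (K <= T)%VS -> spanned K.
Proof.
move=> sK /subvPn[u uK uT] W KW; have uW : u \in W by apply: KW => //; split=> //; exact: sK.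
apply/subvP => w wK; have [wT|wT] := boolP (w \in T); last first.
  by apply: KW => //; split=> //; exact: sK.
rewrite -(addKr u w) rpredD ?rpredN // KW ?rpredD //.
split; last by apply: sK; apply: rpredD.
by apply: contra uT => uwT; rewrite -(addrK w u) rpredB.
Qed.

Lemma lag_line_spanned K : lag_line_space K -> spanned K.
Proof. by case=> _; apply: totally_singular_spanned. Qed.

Lemma spanned_subP K U : spanned K -> section_by K `<=` section_by U <-> (K <= U)%VS.
Proof.
move=> sK; split; last exact: sub_section_by.
by move/section_by_subP/sK.
Qed.

Lemma section_by_inj K U : spanned K -> spanned U -> section_by K = section_by U -> K = U.
Proof.
move=> sK sU KU; apply/eqP; rewrite eqEsubv; apply/andP; split.
  by apply/(spanned_subP _ sK); rewrite KU.
by apply/(spanned_subP _ sU); rewrite KU.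
Qed.

Definition cycle_space A :=
  [/\ \dim A = 3%N, spanned A & forall K, lag_line_space K -> ~~ (K <= A)%VS].

(** Two distinct points [u], [v] of the cycle are not orthogonal, since otherwise they would span a
    line in it. Hence [A] splits into the span of [u] and [v] and vectors [w] orthogonal to both,
    and each such [w] is obtained from a third point of the section. *)
Lemma cyclesP X : cycles T Q X -> exists2 A, cycle_space A & X = section_by A.
Proof.
case=> A [A3 -> [p [q [pA qA pq]]] nL]; exists A => //.
have noline K : lag_line_space K -> ~~ (K <= A)%VS.
  move=> lK; apply/negP => KA; apply: (nL (section_by K)); last exact: sub_section_by.
  by apply/lag_linesP; exists K.
split=> // W AW.
have [u u0 pu] := point_gen p; have [v v0 qv] := point_gen q.
move: pA qA => /(section_byE _ pu)[[uT uu] uA] /(section_byE _ qv)[[vT vv] vA].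
have uv_notin : v \notin <[u]>%VS.
  apply/negP => vu; apply: pq; apply/val_inj; rewrite pu qv.
  apply/esym/sub_dim_eq; first by rewrite -memvE.
  by rewrite !dim_vline u0 v0.
have uv0 : b u v != 0.
  apply/eqP => uv0; have /negP[] : ~~ (<[u]> + <[v]> <= A)%VS.
    apply: noline; split; [exact: dim_line2 | exact: totally_singular_line2 |].
    by apply: contra uT => /subvP; apply; apply: memv_line2l.
  by rewrite addline_sub // -memvE.
have uW : u \in W by apply: AW.
have vW : v \in W by apply: AW.
apply/subvP => a aA.
have [w [wA wu wv aE]] : exists w, [/\ w \in A, b w u = 0, b w v = 0 &
    a = w + (b a u / b u v) *: v + (b a v / b u v) *: u].
  exists (a - (b a v / b u v) *: u - (b a u / b u v) *: v); split.
  - by rewrite !rpredB ?rpredZ.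
  - by rewrite !formE uu (formC b v u); field.
  - by rewrite !formE vv; field.
  - by rewrite !subrK.
have wW : w \in W.
  (* This value makes [u + c *: v + w] singular. The vector is outside [T] because its product with
     [v] is [b u v]. *)
  have [c cE] : exists c, c = - (b w w / (2%:R * b u v)) by eexists.
  have : u + c *: v + w \in W.
    apply: AW; first by rewrite !rpredD ?rpredZ.
    have xv : b (u + c *: v + w) v = b u v by rewrite !formE vv wv mulr0 !addr0.
    split; first by apply: (@notin_radical _ v); rewrite xv.
    rewrite !formE uu vv (formC b v u) (formC b u w) (formC b v w) wu wv.
    by rewrite cE; field; rewrite two_neq0 uv0.
  by rewrite rpredDl // rpredD ?rpredZ.
by rewrite aE !rpredD ?rpredZ.
Qed.

(** * Quadratic cones *)

(** Vector form of [quadratic_cone] with apex [v]. The form [gamma] on the base is tied to [b]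
    through zero sets only, so facts about [b] on the cone have to be derived from those. *)
Definition cone_space U v :=
  exists A (gamma : {symmetric V}),
    [/\ \dim A = 3%N, (A <= U)%VS, v \notin A, v \in U & nondegenerate_on gamma A] /\
    (exists c, [/\ c \in A, c != 0 & gamma c c = 0]) /\
    (forall u, u \in U ->
       b u u = 0 <-> exists c x, [/\ x \in A, gamma x x = 0 & u = c *: v + x]).

Lemma cone_pointE A (gamma : {symmetric V}) (p q : proj_point V) v u :
  let C := [set x : proj_point V |
             (val x <= A)%VS /\ totally_singular gamma (val x)] in
  C !=set0 -> val p = <[v]>%VS -> val q = <[u]>%VS ->
  cone (val p) C q <-> exists c x, [/\ x \in A, gamma x x = 0 & u = c *: v + x].
Proof.
move=> C [y0 y0C] pv qu; split.
  case=> t [y [/points_of_point -> [yA ys]]]; rewrite qu pv -memvE.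
  have [x x0 yx] := point_gen y; rewrite yx => /memv_line2P[a [c ->]].
  exists a, (c *: x); split=> //; last first.
    by apply: ys; rewrite yx; apply/rpredZ/memv_line.
  by apply/rpredZ/(subvP yA); rewrite yx memv_line.
(* For [x = 0] the point is the apex, which lies on the cone only by way of some generator; the
   given point [y0] of the base supplies one. *)
case=> c [x [xA xx uE]]; have [x0|x0] := eqVneq x 0.
  exists p, y0; split=> //; first exact: subvv.
  rewrite qu -memvE uE x0 addr0 pv; apply: (subvP (addvSl _ _)).
  exact/rpredZ/memv_line.
have [y yx] := ex_point x0; exists p, y; split; first exact: subvv.
  by split; rewrite yx -?memvE //; apply: totally_singular_line.
by rewrite qu pv yx -memvE uE memv_add ?rpredZ ?memv_line.
Qed.

Lemma quadratic_coneP U p v : val p = <[v]>%VS ->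
  quadratic_cone U p (points_of U `&` lag_cone T Q) <-> cone_space U v.
Proof.
move=> pv; split.
  case=> A [C [[A3 AU pA pU] [[gamma [nd CE]] C0 XE]]].
  exists A, gamma; split; last split.
  - by split=> //; [apply/negP => /(points_of_line _ pv) | apply/(points_of_line _ pv)].
  - case: C0 => c; rewrite CE /= => -[cA cs]; have [x x0 cx] := point_gen c.
    by exists x; split=> //; [rewrite memvE -cx | apply: cs; rewrite cx memv_line].
  move=> u uU; have [->|u0] := eqVneq u 0.
    rewrite form0l; split=> // _.
    by exists 0, 0; rewrite mem0v form0l scale0r addr0.
  have [q qu] := ex_point u0; rewrite CE in C0 XE.
  rewrite -(cone_pointE C0 pv qu) -XE -totally_singular_lineE -qu -lag_coneE.
  by split=> [|[]//]; split=> //; apply/(points_of_line _ qu).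
case=> A [gamma [[A3 AU vA vU nd] [[c [cA c0 cc]] coneE]]].
have [y yc] := ex_point c0.
pose C := [set x : proj_point V | (val x <= A)%VS /\ totally_singular gamma (val x)].
have C0 : C !=set0.
  by exists y; split; rewrite yc -?memvE //; apply: totally_singular_line.
exists A, C; split; split=> //.
- by move/(points_of_line _ pv); apply/negP.
- exact/(points_of_line _ pv).
- by exists gamma.
apply/seteqP; split=> q; have [u u0 qu] := point_gen q.
  case=> /(points_of_line _ qu) uU /lag_coneE; rewrite qu => /totally_singular_lineE uu.
  exact/(cone_pointE C0 pv qu)/coneE.
move/(cone_pointE C0 pv qu) => uE; have uU : u \in U.
  by case: uE => a [x [xA _ ->]]; rewrite rpredD ?rpredZ // (subvP AU).
split; first exact/(points_of_line _ qu).
by apply/lag_coneE; rewrite qu; apply/totally_singular_lineE/coneE.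
Qed.

Lemma cone_space_apex U v : cone_space U v -> [/\ v \in U, v != 0 & b v v = 0].
Proof.
case=> A [gamma [[_ _ vA vU _] [_ coneE]]]; split=> //.
  by apply: contraNneq vA => ->; apply: mem0v.
by apply/coneE => //; exists 1, 0; rewrite mem0v form0l scale1r addr0.
Qed.

(** Adding the apex to a vector of the cone stays on the cone, so polarization applies. *)
Lemma cone_space_orthogonal U v u : cone_space U v -> u \in U -> b u u = 0 -> b u v = 0.
Proof.
move=> cU uU uu; have [vU _ vv] := cone_space_apex cU.
apply: polarization => //.
case: cU => A [gamma [_ [_ coneE]]]; apply/(coneE _ (rpredD uU vU)).
have [c [x [xA xx ->]]] := proj1 (coneE _ uU) uu.
by exists (c + 1), x; rewrite scalerDl scale1r addrAC.
Qed.

(** Inside the solid [U], the plane [E] meets the base [A] in dimension at least 2. The form [gamma]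
    vanishes on this intersection, because a vector of [A] on the cone can have no component along
    [v]; but a nondegenerate form in dimension 3 has no totally singular subspace of dimension 2. *)
Lemma cone_space_no_singular_plane U v E : \dim U = 4%N -> cone_space U v ->
  (E <= U)%VS -> \dim E = 3%N -> ~ totally_singular b E.
Proof.
move=> U4 [A [gamma [[A3 AU vA vU nd] [_ coneE]]]] EU E3 sE.
have sEA : totally_singular gamma (E :&: A)%VS.
  move=> w; rewrite memv_cap => /andP[wE wA].
  have [c [x [xA xx wcx]]] := proj1 (coneE _ (subvP EU _ wE)) (sE _ wE).
  suff c0 : c = 0 by rewrite wcx c0 scale0r add0r.
  apply: contraNeq vA => c0; rewrite -(scalerK c0 v) rpredZ //.
  by rewrite -(addrK x (c *: v)) -wcx rpredB.
have := totally_singular_dim two_neq0 nd sEA (capvSr _ _).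
have := dim_cap_ge EU AU; rewrite A3 E3 U4.
by case: (\dim (E :&: A)) => [|[|[|]]] //; case.
Qed.

(** A line missing the apex would span a totally singular plane with it. *)
Lemma cone_space_line_apex U v K : \dim U = 4%N -> cone_space U v ->
  (K <= U)%VS -> \dim K = 2%N -> totally_singular b K -> v \in K.
Proof.
move=> U4 cU KU K2 sK; apply: contrapT => /negP vK.
have [vU v0 vv] := cone_space_apex cU.
apply: (cone_space_no_singular_plane U4 cU (addline_sub KU vU)).
  by rewrite dim_addline // K2.
apply: totally_singular_addline => // w wK.
by apply: (cone_space_orthogonal cU); [apply: (subvP KU) | apply: sK].
Qed.

(** * Nondegenerate sections *)

(** Once more [gamma] is related to [b] by zero sets only. Since the section omits [T], no nonzero
    vector of [U] in [T] is singular for [gamma]. *)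
Definition nondegenerate_section U (gamma : {symmetric V}) :=
  nondegenerate_on gamma U /\
  forall u, u \in U -> u != 0 -> (gamma u u = 0 <-> lag_vector u).

Lemma nondegenerate_quadricP U : nondegenerate_quadric U (section_by U) <->
  exists gamma, nondegenerate_section U gamma.
Proof.
split=> -[gamma [nd UE]]; exists gamma; split=> //.
  move=> u uU u0; have [p pu] := ex_point u0.
  have := section_byE U pu; rewrite UE /= pu -memvE => pE; split=> [uu|lu].
    by apply: (proj1 (proj1 pE _)); split=> //; apply: totally_singular_line.
  by have /pE[_] := conj lu uU; apply; apply: memv_line.
apply/seteqP; split=> p; have [u u0 pu] := point_gen p.
  move/(section_byE _ pu) => [lu uU]; split; rewrite pu -?memvE //.
  by apply: totally_singular_line; apply/UE.
case; rewrite pu -memvE => uU us; apply/(section_byE _ pu); split=> //.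
by apply/UE => //; apply: us; apply: memv_line.
Qed.

(** Makes the dimension bound for [gamma] available for subspaces that are singular for [b]. *)
Lemma nondegenerate_section_singular U gamma K : nondegenerate_section U gamma ->
  (K <= U)%VS -> totally_singular b K -> ~~ (K <= T)%VS -> totally_singular gamma K.
Proof.
move=> [_ UE] KU sK /subvPn[u uK uT].
have lag0 x : x \in K -> x \notin T -> gamma x x = 0.
  move=> xK xT; have lx : lag_vector x by split=> //; apply: sK.
  by apply/UE => //; [apply: (subvP KU) | apply: lag_vector_neq0].
move=> w wK; have [wT|] := boolP (w \in T); last exact: lag0.
(* Parallelogram law: [u + w] and [u - w] avoid [T]. *)
have pT : u + w \notin T by rewrite rpredDr.
have mT : u - w \notin T by rewrite rpredBr.
have : 2%:R * gamma w w + 2%:R * gamma u u =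
    gamma (u + w) (u + w) + gamma (u - w) (u - w).
  by rewrite !formE (formC gamma w u); ring.
rewrite (lag0 _ uK uT) (lag0 _ (rpredD uK wK) pT) (lag0 _ (rpredB uK wK) mT).
rewrite mulr0 !addr0.
by move/eqP; rewrite mulf_eq0 (negPf two_neq0) => /eqP.
Qed.

(** The form [gamma] vanishes on all of [K] but on no nonzero vector of [U] in [T]. So every line in
    such a section is projective. *)
Lemma nondegenerate_section_projective U gamma K : nondegenerate_section U gamma ->
  (K <= U)%VS -> totally_singular b K -> ~~ (K <= T)%VS -> (K :&: T)%VS = 0%VS.
Proof.
move=> nU KU sK KT; have gK := nondegenerate_section_singular nU KU sK KT.
case: nU => _ UE; apply/eqP; rewrite -subv0; apply/subvP=> u; rewrite memv_cap memv0.
move=> /andP[uK uT]; apply: contraTT uT => u0.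
by have /(UE _ (subvP KU _ uK) u0)[] := gK _ uK.
Qed.

(** * Members of [wp2] as sections *)

(** The seven classes grouped by what the argument distinguishes: the three kinds of planes are
    merged, and so are Möbius and Minkowski planes. *)
Inductive wp2_spec : set (proj_point V) -> Prop :=
| SingularPlane U of \dim U = 3%N & totally_singular b U :
    wp2_spec (section_by U)
| AffineCone U v of \dim U = 4%N & cone_space U v & v \in T :
    wp2_spec (section_by U)
| ProjectiveCone U v of \dim U = 4%N & cone_space U v & v \notin T :
    wp2_spec (section_by U)
| NondegenerateSection U gamma of \dim U = 4%N & nondegenerate_section U gamma :
    wp2_spec (section_by U).

Lemma wp2P Y : wp2 T Q Y -> wp2_spec Y.
Proof.
case=> [[[[[[|]|]|]|]|]|].
- case=> E [E3 /points_of_lag_coneP sE ET ->].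
  by rewrite section_by_projective //; apply: SingularPlane.
- case=> E [E3 /points_of_lag_coneP sE _ ->].
  by rewrite section_by_affine //; apply: SingularPlane.
- case=> E [E3 /points_of_lag_coneP sE _ ->].
  by rewrite section_by_affine //; apply: SingularPlane.
- case=> U [p [U4 pT cU ->]]; have [v v0 pv] := point_gen p.
  apply: (@AffineCone _ v) => //; first exact/(quadratic_coneP _ pv).
  exact/(points_of_line _ pv).
- case=> U [p [U4 pS cU ->]]; have [v v0 pv] := point_gen p.
  move/(lag_pointE pv): pS => [vT _].
  by apply: (@ProjectiveCone _ v) => //; apply/(quadratic_coneP _ pv).
- case=> U [U4 [-> [/nondegenerate_quadricP[gamma nU] _ _]]].
  exact: (@NondegenerateSection _ gamma).
- case=> U [U4 [-> [/nondegenerate_quadricP[gamma nU] _]]].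
  exact: (@NondegenerateSection _ gamma).
Qed.

Lemma projective_conesP Y : projective_cones T Q Y <->
  exists U v, [/\ \dim U = 4%N, cone_space U v, v \notin T & Y = section_by U].
Proof.
split=> [[U [p [U4 pS cU ->]]]|[U [v [U4 cU vT ->]]]].
  have [v v0 pv] := point_gen p; move/(lag_pointE pv): pS => [vT _].
  by exists U, v; split=> //; apply/(quadratic_coneP _ pv).
have [_ v0 vv] := cone_space_apex cU; have [p pv] := ex_point v0.
exists U, p; split=> //; first exact/(lag_pointE pv).
exact/(quadratic_coneP _ pv).
Qed.

(** The last clause says that a singular plane not inside [T] fits only into itself: cones contain
    no singular plane, and in a nondegenerate section the dimension bound would read 3 + 3 <= 4. *)
Lemma wp2_section Y : wp2 T Q Y -> exists U, [/\ Y = section_by U, (\dim U <= 4)%N &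
  forall E, \dim E = 3%N -> totally_singular b E -> ~~ (E <= T)%VS -> (E <= U)%VS -> U = E].
Proof.
have nd U gamma E : \dim U = 4%N -> nondegenerate_section U gamma ->
    \dim E = 3%N -> totally_singular b E -> ~~ (E <= T)%VS -> (E <= U)%VS -> U = E.
  move=> U4 nU E3 sE ET EU.
  have gE := nondegenerate_section_singular nU EU sE ET.
  by have := totally_singular_dim two_neq0 (proj1 nU) gE EU; rewrite E3 U4.
case/wp2P=> {Y} U; [move=> U3 sU|move=> v U4 cU _|move=> v U4 cU _|
    move=> gamma U4 nU]; exists U; split; rewrite ?U3 ?U4 //.
- by move=> E E3 _ _ EU; apply/esym/sub_dim_eq; rewrite ?U3 ?E3.
- by move=> E E3 sE _ EU; case: (cone_space_no_singular_plane U4 cU EU E3 sE).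
- by move=> E E3 sE _ EU; case: (cone_space_no_singular_plane U4 cU EU E3 sE).
- by move=> E; apply: (nd _ _ _ U4 nU).
Qed.

(** * Adjacency and concurrent lines *)

Definition adjacent X1 X2 :=
  X1 <> X2 /\ exists Y1 Y2, [/\ wp2 T Q Y1, wp2 T Q Y2, Y1 <> Y2,
    X1 `<=` Y1 /\ X2 `<=` Y1 & X1 `<=` Y2 /\ X2 `<=` Y2].

Lemma wp1P X : wp1 T Q X ->
  exists K, [/\ spanned K, X = section_by K & lag_line_space K \/ cycle_space K].
Proof.
case=> [/cyclesP[A cA ->]|/lag_linesP[K lK ->]].
  by exists A; split=> //; [case: cA | right].
by exists K; split=> //; [apply: lag_line_spanned | left].
Qed.

Lemma dim_lag_lines K1 K2 : lag_line_space K1 -> lag_line_space K2 ->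
  section_by K1 <> section_by K2 -> (2 < \dim (K1 + K2))%N.
Proof.
move=> [d1 _ _] [d2 _ _] neq; rewrite ltnNge; apply/negP => le2; apply: neq.
have E1 := sub_dim_eq (addvSl K1 K2); have E2 := sub_dim_eq (addvSr K1 K2).
by congr section_by; rewrite [LHS]E1 ?d1 // [RHS]E2 ?d2.
Qed.

Lemma adjacentP X1 X2 : wp1 T Q X1 -> wp1 T Q X2 -> adjacent X1 X2 ->
  exists K1 K2, [/\ lag_line_space K1 /\ X1 = section_by K1,
    lag_line_space K2 /\ X2 = section_by K2,
    \dim (K1 + K2) = 3%N & ~ totally_singular b (K1 + K2)].
Proof.
move=> /wp1P[K1 [s1 -> K1P]] /wp1P[K2 [s2 -> K2P]] [X12 [Y1 [Y2]]].
case=> /wp2_section[U1 [-> U1_4 U1E]] /wp2_section[U2 [-> U2_4 U2E]] Y12.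
move=> [/(spanned_subP _ s1) K11 /(spanned_subP _ s2) K21].
move=> [/(spanned_subP _ s1) K12 /(spanned_subP _ s2) K22].
have S1 : (K1 + K2 <= U1)%VS by rewrite subv_add K11.
have S2 : (K1 + K2 <= U2)%VS by rewrite subv_add K12.
have S3 : (\dim (K1 + K2) <= 3)%N.
  rewrite leqNgt; apply/negP => S4; apply: Y12; congr section_by.
  rewrite -(sub_dim_eq S1) ?(leq_trans U1_4) //.
  by rewrite (sub_dim_eq S2) // (leq_trans U2_4).
(* A cycle would fill the whole plane [K1 + K2]; that plane would then contain no line, and a second
   cycle would equal the first. *)
have noline K A : lag_line_space K -> cycle_space A -> (K <= K1 + K2)%VS ->
    (A <= K1 + K2)%VS -> False.
  move=> lK [A3 _ nA] KS AS; have /negP[] := nA _ lK.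
  by rewrite (sub_dim_eq AS) // A3.
have l1l : (K1 <= K1 + K2)%VS := addvSl _ _; have l2r : (K2 <= K1 + K2)%VS := addvSr _ _.
case: K1P K2P => [l1|c1] [l2|c2]; first last.
- case: X12; congr section_by; case: c1 c2 => [A3 _ _] [B3 _ _].
  by rewrite [LHS](sub_dim_eq l1l) ?A3 // [RHS](sub_dim_eq l2r) ?B3.
- by case: (noline _ _ l2 c1).
- by case: (noline _ _ l1 c2).
have d3 : \dim (K1 + K2) = 3%N by apply/eqP; rewrite eqn_leq S3 dim_lag_lines.
exists K1, K2; split=> // sS; apply: Y12.
have ST : ~~ (K1 + K2 <= T)%VS by case: l1 => _ _; apply: contra; apply: subv_trans.
by rewrite (U1E _ d3 sS ST S1) (U2E _ d3 sS ST S2).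
Qed.

(** * Construction of Minkowski planes and affine cones *)

Lemma nondegenerate_radical U : nondegenerate_on b U -> forall t, t \in U -> t \in T -> t = 0.
Proof. by move=> nd t tU tT; apply: nd => // v _; apply: form_radicall. Qed.

Lemma nondegenerate_on_section U : nondegenerate_on b U -> nondegenerate_section U b.
Proof.
move=> nd; split=> // u uU u0; split=> [uu|[]//]; split=> //.
by apply: contra u0 => uT; rewrite (nondegenerate_radical nd uU uT).
Qed.

Lemma minkowski_planeI U K : \dim U = 4%N -> nondegenerate_on b U ->
  (K <= U)%VS -> \dim K = 2%N -> totally_singular b K ->
  minkowski_planes T Q (section_by U).
Proof.
move=> U4 nd KU K2 sK; exists U; split=> //; split=> //; split.
  by apply/nondegenerate_quadricP; exists b; apply: nondegenerate_on_section.
exists K; split=> // p pK; have [u u0 pu] := point_gen p.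
have uK : u \in K by apply/(points_of_line _ pu).
have uU := subvP KU _ uK; apply/(section_byE _ pu); split=> //.
by apply/(proj2 (nondegenerate_on_section nd)) => //; apply: sK.
Qed.

(* [v, z] and [x1, x2] are orthogonal hyperbolic pairs. *)
Definition hyperbolic_frame v x1 x2 z :=
  [/\ b v v = 0, b x1 x1 = 0, b x2 x2 = 0 & b z z = 0] /\
  [/\ b v x1 = 0, b v x2 = 0, b z x1 = 0 & b z x2 = 0] /\
  b x1 x2 != 0 /\ b v z != 0.

Lemma hyperbolic_frame_nondegenerate v x1 x2 z : hyperbolic_frame v x1 x2 z ->
  let U := (<[v]> + <[x1]> + <[x2]> + <[z]>)%VS in
  \dim U = 4%N /\ nondegenerate_on b U.
Proof.
move=> [[vv x11 x22 zz] [[vx1 vx2 zx1 zx2] [x12 vz]]] /=; split.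
  have v0 : v != 0 by apply: contraNneq vz => ->; rewrite form0l.
  rewrite !dim_addline ?dim_vline ?v0 //.
  - by apply: contra x12 => /vlineP[c ->]; rewrite !formE vx2 mulr0.
  - apply: contra x12 => /memv_line2P[c [a ->]].
    by rewrite !formE (formC b x1 v) vx1 x11 !mulr0 addr0.
  - apply: contra vz => /memv_addlineP[_ /memv_line2P[c [a ->]] [e ->]].
    by rewrite !formE vv vx1 vx2 !mulr0 !addr0.
move=> u /memv_addlineP[_ /memv_addlineP[_ /memv_line2P[c1 [c2 ->]] [c3 ->]] [c4 ->]] uU.
have mem w : w \in [:: v; x1; x2; z] -> w \in (<[v]> + <[x1]> + <[x2]> + <[z]>)%VS.
  rewrite !inE => /or4P[] /eqP ->; rewrite ?memv_addline //.
  - exact/(subvP (addvSl _ _))/(subvP (addvSl _ _))/memv_line2l.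
  - exact/(subvP (addvSl _ _))/(subvP (addvSl _ _))/memv_addline.
  - exact/(subvP (addvSl _ _))/memv_addline.
(* The product of [u] with each of the four vectors isolates the coefficient of its hyperbolic
   partner. *)
have := uU v (mem _ _); have := uU x1 (mem _ _); have := uU x2 (mem _ _).
have := uU z (mem _ _); rewrite !inE !eqxx !orbT.
rewrite !formE (formC b x1 v) (formC b x1 z) (formC b x2 z) (formC b x2 v).
rewrite (formC b x2 x1) (formC b z v).
rewrite vv x11 x22 zz vx1 vx2 zx1 zx2 !(mulr0, addr0, add0r).
do 4![move=> /(_ isT) /eqP; rewrite mulf_eq0 ?(negPf x12) ?(negPf vz) orbF => /eqP ->].
by rewrite !scale0r !addr0.
Qed.

(** Outside the radical, [v] has a nonzero product with some [z0]. Removing the components of [z0]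
    along [x1] and [x2] keeps that product, as [v] is orthogonal to both; a final shift along [v]
    makes the vector singular and preserves everything else. *)
Lemma ex_hyperbolic_frame v x1 x2 : v \notin T ->
  b v v = 0 -> b x1 x1 = 0 -> b x2 x2 = 0 -> b v x1 = 0 -> b v x2 = 0 -> b x1 x2 != 0 ->
  exists z, hyperbolic_frame v x1 x2 z.
Proof.
move=> vT vv x11 x22 vx1 vx2 x12.
have [z0 vz0] : exists z0, b v z0 != 0.
  apply: contrapT => nz; case/negP: vT; apply/radicalP => z0.
  by apply: contrapT => /eqP vz0; apply: nz; exists z0.
have [z1 [vz1 z1x1 z1x2]] : exists z1, [/\ b v z1 != 0, b z1 x1 = 0 & b z1 x2 = 0].
  exists (z0 - (b z0 x2 / b x1 x2) *: x1 - (b z0 x1 / b x1 x2) *: x2); split.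
  - by rewrite !formE vx1 vx2 !mulr0 !subr0.
  - by rewrite !formE x11 (formC b x2 x1); field.
  - by rewrite !formE x22; field.
exists (z1 - (b z1 z1 / (2%:R * b v z1)) *: v); do 3?split=> //.
- by rewrite !formE (formC b z1 v) vv; field; rewrite two_neq0 vz1.
- by rewrite !formE z1x1 vx1 mulr0 subr0.
- by rewrite !formE z1x2 vx2 mulr0 subr0.
- by rewrite !formE vv mulr0 subr0.
Qed.

(** The second hypothesis provides orthogonal projections onto [D]. If all vectors orthogonal to [D]
    were singular, polarization and these projections would put them in [T]; then [D + T] would be
    the whole space, against the codimension of [T]. *)
Lemma ex_orthogonal_nonsingular D : (\dim D <= 3)%N ->
  (forall u, exists2 d, d \in D & forall e, e \in D -> b (u - d) e = 0) ->
  exists w, b w w != 0 /\ forall d, d \in D -> b w d = 0.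
Proof.
move=> D3 projD; apply: contrapT => noW.
have perp_sing w : (forall d, d \in D -> b w d = 0) -> b w w = 0.
  by move=> wD; apply: contrapT => /eqP ww; apply: noW; exists w.
have perpT w : (forall d, d \in D -> b w d = 0) -> w \in T.
  move=> wD; apply/radicalP => u; have [d dD ud] := projD u.
  rewrite -(subrK d u) formDr (wD d dD) addr0.
  apply: polarization => //; apply: perp_sing => // e eD.
  by rewrite formDl (wD e eD) (ud e eD) addr0.
have : (\dim {:V} <= \dim (D + T))%N.
  apply: dimvS; apply/subvP=> u _; have [d dD ud] := projD u.
  by rewrite -(subrK d u) addrC memv_add // perpT.
apply/negP; rewrite -ltnNge; apply: leq_trans codim_radical.
by rewrite addnC addSn ltnS (leq_trans (dimv_add_leqif _ _)) // leq_add2r.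
Qed.

(** Adding a radical vector does not change the form, so [b] itself serves as the form on the base
    [A]. *)
Lemma affine_coneI A v x : \dim A = 3%N -> nondegenerate_on b A ->
  x \in A -> x != 0 -> b x x = 0 -> v \in T -> v != 0 ->
  affine_cones T Q (section_by (A + <[v]>)).
Proof.
move=> A3 nd xA x0 xx vT v0; have [p pv] := ex_point v0.
have vA : v \notin A.
  by apply: contra v0 => vA; rewrite (nondegenerate_radical nd vA vT).
exists (A + <[v]>)%VS, p; split=> //; first by rewrite dim_addline // A3.
  exact/(points_of_line _ pv).
apply/(quadratic_coneP _ pv); exists A, b; split; last split.
- by split=> //; [apply: addvSl | apply: memv_addline].
- by exists x.
have bE c y : b (c *: v + y) (c *: v + y) = b y y.
  by rewrite !formE !(form_radicall _ vT) (form_radicalr _ vT); ring.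
move=> u /memv_addlineP[k kA [c ->]]; rewrite addrC bE; split=> [kk|].
  by exists c, k.
case=> a [y [yA yy]] E; suff -> : k = y by [].
have vT0 : (c - a) *: v \in T by rewrite rpredZ.
have yk : y - k \in A by rewrite rpredB.
have ykE : y - k = (c - a) *: v.
  by rewrite scalerBl; apply/eqP; rewrite subr_eq addrAC eq_sym subr_eq E addrC.
rewrite -ykE in vT0.
by apply/esym/eqP; rewrite -subr_eq0 (nondegenerate_radical nd yk vT0).
Qed.

(** Two rounds of [ex_orthogonal_nonsingular]: first against the hyperbolic plane of [x1] and [x2],
    then against that plane enlarged by [w1]. Both admit explicit orthogonal projections. *)
Lemma ex_orthogonal_pair x1 x2 : b x1 x1 = 0 -> b x2 x2 = 0 -> b x1 x2 != 0 ->
  exists w1 w2, [/\ b w1 w1 != 0, b w2 w2 != 0 & b w2 w1 = 0] /\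
    [/\ b w1 x1 = 0, b w1 x2 = 0, b w2 x1 = 0 & b w2 x2 = 0].
Proof.
move=> x11 x22 x12; pose D := (<[x1]> + <[x2]>)%VS.
have D2 : (\dim D <= 2)%N.
  rewrite (leq_trans (dimv_add_leqif _ _)) // !dim_vline.
  by case: (x1 != 0); case: (x2 != 0).
have projD u : exists2 d, d \in D & forall e, e \in D -> b (u - d) e = 0.
  exists ((b u x2 / b x1 x2) *: x1 + (b u x1 / b x1 x2) *: x2); first exact: memv_line2I.
  move=> _ /memv_line2P[a [c ->]].
  by rewrite !formE x11 x22 (formC b x2 x1); field.
have [w1 [w11 w1D]] := ex_orthogonal_nonsingular (leqW D2) projD.
have [] := @ex_orthogonal_nonsingular (D + <[w1]>)%VS.
- rewrite (leq_trans (dimv_add_leqif _ _)) // dim_vline.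
  by case: (w1 != 0); rewrite ?addn0 ?addn1 // leqW.
- move=> u; have [d dD ud] := projD u.
  exists (d + (b u w1 / b w1 w1) *: w1); first exact: memv_addlineI.
  move=> _ /memv_addlineP[e eD [c ->]]; rewrite opprD addrA.
  rewrite formDl formNl formZl !(formDr _ _ (c *: w1)) ud // (w1D e) // !formZr.
  rewrite !add0r formDl formNl.
  by rewrite (formC b d w1) (w1D d) //; field.
move=> w2 [w22 w2D]; exists w1, w2; split; split=> //.
- by apply: w2D; apply: memv_addline.
- by apply: w1D; apply: memv_line2l.
- by apply: w1D; apply: memv_addline.
- exact/w2D/(subvP (addvSl _ _))/memv_line2l.
- exact/w2D/(subvP (addvSl _ _))/memv_addline.
Qed.

Lemma adjacent_concurrent v x1 x2 : v != 0 ->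
  b v v = 0 -> b x1 x1 = 0 -> b x2 x2 = 0 -> b v x1 = 0 -> b v x2 = 0 -> b x1 x2 != 0 ->
  adjacent (section_by (<[v]> + <[x1]>)) (section_by (<[v]> + <[x2]>)).
Proof.
move=> v0 vv x11 x22 vx1 vx2 x12.
have x1T := notin_radical x12.
have x2T : x2 \notin T by apply: (@notin_radical _ x1); rewrite formC.
have sp x : b x x = 0 -> b v x = 0 -> x \notin T -> spanned (<[v]> + <[x]>)%VS.
  move=> xx vx xT; apply: totally_singular_spanned; first exact: totally_singular_line2.
  by apply: contra xT => /subvP; apply; apply: memv_addline.
split.
  move/section_by_inj => /(_ (sp _ x11 vx1 x1T) (sp _ x22 vx2 x2T)) E.
  case/negP: x12; have : x2 \in (<[v]> + <[x1]>)%VS by rewrite E memv_addline.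
  by case/memv_line2P=> a [c ->]; rewrite !formE (formC b x1 v) vx1 x11 !mulr0 addr0.
have [vT|vT] := boolP (v \in T); last first.
  have [z zP] := ex_hyperbolic_frame vT vv x11 x22 vx1 vx2 x12.
  have [t tT t0] : exists2 t, t \in T & t != 0 by apply: ex_neq0; rewrite lt0n dimv_eq0.
  have ztP : hyperbolic_frame v x1 x2 (z + t).
    case: zP => [[_ _ _ zz] [[_ _ zx1 zx2] [_ vz]]]; do 3?split=> //;
      by rewrite !formE ?(form_radicall _ tT) ?(form_radicalr _ tT) ?addr0 ?zz.
  have [U4 nd] := hyperbolic_frame_nondegenerate zP.
  have [U'4 nd'] := hyperbolic_frame_nondegenerate ztP.
  have sub w : (<[v]> + <[x1]> <= <[v]> + <[x1]> + <[x2]> + <[w]>)%VS /\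
               (<[v]> + <[x2]> <= <[v]> + <[x1]> + <[x2]> + <[w]>)%VS.
    split; apply: subv_trans (addvSl _ _); first exact: addvSl.
    by apply: addvS => //; apply: addvSl.
  have d2 : \dim (<[v]> + <[x1]>) = 2%N.
    apply: dim_line2 => //; apply: contra x12 => /vlineP[c ->].
    by rewrite formZl vx2 mulr0.
  exists (section_by (<[v]> + <[x1]> + <[x2]> + <[z]>)).
  exists (section_by (<[v]> + <[x1]> + <[x2]> + <[z + t]>)); split.
  - right; apply: (minkowski_planeI U4 nd (proj1 (sub z)) d2).
    exact: totally_singular_line2.
  - right; apply: (minkowski_planeI U'4 nd' (proj1 (sub _)) d2).
    exact: totally_singular_line2.
  - case: zP => [[_ _ _ zz] [_ [_ vz]]].
    have zU := memv_addline (<[v]> + <[x1]> + <[x2]>)%VS z.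
    have lz : lag_vector z by split=> //; apply: (@notin_radical _ v); rewrite formC.
    (* If the sections agreed, the second subspace would contain both [z] and [z + t], hence the
       nonzero radical vector [t]. *)
    move=> E; have /section_by_subP/(_ z zU lz) zU' :
        section_by (<[v]> + <[x1]> + <[x2]> + <[z]>) `<=`
        section_by (<[v]> + <[x1]> + <[x2]> + <[z + t]>) by rewrite E.
    case/negP: t0; apply/eqP/(nondegenerate_radical nd') => //.
    have ztU' := memv_addline (<[v]> + <[x1]> + <[x2]>)%VS (z + t).
    by have := rpredB ztU' zU'; rewrite addrC addKr.
  - by split; apply: sub_section_by; case: (sub z).
  - by split; apply: sub_section_by; case: (sub (z + t)).
have [w1 [w2 [[w11 w22 w21] [w1x1 w1x2 w2x1 w2x2]]]] := ex_orthogonal_pair x11 x22 x12.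
have x10 : x1 != 0 by apply: contraNneq x12 => ->; rewrite form0l.
pose A w := (<[x1]> + <[x2]> + <[w]>)%VS.
have Ax1 w : x1 \in A w by apply/(subvP (addvSl _ _))/memv_line2l.
have Ax2 w : x2 \in A w by apply/(subvP (addvSl _ _))/memv_addline.
have AP w : b w w != 0 -> b w x1 = 0 -> b w x2 = 0 ->
    \dim (A w) = 3%N /\ nondegenerate_on b (A w).
  move=> ww wx1 wx2; split.
    rewrite dim_addline ?dim_line2 //.
      by apply: contra x12 => /vlineP[c ->]; rewrite formZr x11 mulr0.
    apply: contra ww => /memv_line2P[a [c {1}->]].
    by rewrite !formE (formC b x1) (formC b x2) wx1 wx2 !mulr0 addr0.
  move=> u /memv_addlineP[_ /memv_line2P[c1 [c2 ->]] [c3 ->]] uA.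
  have := uA w (memv_addline _ _); have := uA x1 (Ax1 w); have := uA x2 (Ax2 w).
  rewrite !formE (formC b x1 w) (formC b x2 w) (formC b x2 x1) wx1 wx2 x11 x22.
  rewrite !(mulr0, addr0, add0r).
  do 3![move/eqP; rewrite mulf_eq0 ?(negPf x12) ?(negPf ww) orbF => /eqP ->].
  by rewrite !scale0r !addr0.
have cone_wp2 w : b w w != 0 -> b w x1 = 0 -> b w x2 = 0 ->
    wp2 T Q (section_by (A w + <[v]>)).
  move=> ww wx1 wx2; have [A3 nd] := AP w ww wx1 wx2.
  by left; left; left; right; apply: (affine_coneI A3 nd (Ax1 w)).
have sub w x : x \in A w -> section_by (<[v]> + <[x]>) `<=` section_by (A w + <[v]>).
  move=> xA; apply: sub_section_by; apply: addline_sub; first exact: addvSr.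
  exact: (subvP (addvSl _ _)).
exists (section_by (A w1 + <[v]>)), (section_by (A w2 + <[v]>)); split.
- exact: cone_wp2.
- exact: cone_wp2.
(* A point telling the two cones apart: the coefficient of [x2] makes [s] singular, and its product
   with [w1] is [b w1 w1], which is nonzero, whereas the second cone lies in the space orthogonal to
   [w1]. *)
- move=> E; pose s := x1 - (b w1 w1 / (2%:R * b x1 x2)) *: x2 + w1.
  have sU : s \in (A w1 + <[v]>)%VS.
    apply: (subvP (addvSl _ _)); apply: rpredD (memv_addline _ _).
    exact: rpredB (Ax1 w1) (rpredZ _ (Ax2 w1)).
  have ss : b s s = 0.
    rewrite /s !formE (formC b x1 w1) (formC b x2 w1) (formC b x2 x1) w1x1 w1x2 x11 x22.
    by field; rewrite two_neq0 x12.
  have sx2 : b s x2 = b x1 x2 by rewrite /s !formE x22 w1x2; ring.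
  have ls : lag_vector s by split=> //; apply: (@notin_radical _ x2); rewrite sx2.
  have /section_by_subP/(_ s sU ls) :
    section_by (A w1 + <[v]>) `<=` section_by (A w2 + <[v]>) by rewrite E.
  have sw1 : b s w1 = b w1 w1.
    by rewrite /s !formE (formC b x1 w1) (formC b x2 w1) w1x1 w1x2; ring.
  case/memv_addlineP=> _ /memv_addlineP[_ /memv_line2P[a1 [a2 ->]] [a3 ->]] [a4 sE].
  case/negP: w11; rewrite -sw1 sE !formE w21 (form_radicall _ vT).
  by rewrite (formC b x1 w1) (formC b x2 w1) w1x1 w1x2 !mulr0 !addr0.
- by split; apply: sub.
- by split; apply: sub.
Qed.

(** Both lines pass through the apex, and their other generators are not orthogonal, since otherwise
    the cone would contain a singular plane. *)
Lemma cone_space_lines_adjacent U v K1 K2 : \dim U = 4%N -> cone_space U v ->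
  lag_line_space K1 -> lag_line_space K2 -> (K1 <= U)%VS -> (K2 <= U)%VS ->
  section_by K1 <> section_by K2 -> adjacent (section_by K1) (section_by K2).
Proof.
move=> U4 cU l1 l2 K1U K2U K12; have [vU v0 vv] := cone_space_apex cU.
have ge3 := dim_lag_lines l1 l2 K12.
have gen K : lag_line_space K -> (K <= U)%VS ->
    exists x, [/\ K = (<[v]> + <[x]>)%VS, b x x = 0 & b v x = 0].
  case=> [K2' sK _] KU; have vK := cone_space_line_apex U4 cU KU K2' sK.
  have [x xv KE] := dim2_gen K2' vK v0; exists x.
  have xK : x \in K by rewrite KE memv_addline.
  by split=> //; [apply: sK | apply: (totally_singular_form two_neq0 sK)].
have [x1 [K1E x11 vx1]] := gen _ l1 K1U; have [x2 [K2E x22 vx2]] := gen _ l2 K2U.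
have SE : (K1 + K2)%VS = (K1 + <[x2]>)%VS.
  rewrite K2E addvA [X in (X + _)%VS](_ : _ = K1) //; apply/addv_idPl.
  by rewrite K1E addvSl.
have x2K1 : x2 \notin K1.
  apply/negP=> xK; have : (K1 + <[x2]>)%VS = K1 by apply/addv_idPl; rewrite -memvE.
  by rewrite -SE => E; rewrite E in ge3; case: l1 ge3 => ->.
rewrite K1E K2E; apply: adjacent_concurrent => //; apply/eqP => x12.
have SU : (K1 + <[x2]> <= U)%VS by rewrite -SE subv_add K1U.
apply: (cone_space_no_singular_plane U4 cU SU).
  by rewrite dim_addline //; case: l1 => ->.
apply: totally_singular_addline => //; first by case: l1.
by move=> w; rewrite K1E => /memv_line2P[a [c ->]]; rewrite !formE vx2 x12 !mulr0 addr0.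
Qed.

(** * Reguli in sections *)

(** On a Minkowski plane [X1] and [X2] are two lines of one regulus and [X] is a line of the
    opposite one. *)
Definition contains_regulus Y := exists X X1 X2,
  [/\ wp1 T Q X, wp1 T Q X1 & wp1 T Q X2] /\ [/\ X `<=` Y, X1 `<=` Y & X2 `<=` Y] /\
  [/\ adjacent X X1, adjacent X X2, X1 <> X2 & ~ adjacent X1 X2].

Lemma section_form_singular U gamma x : nondegenerate_section U gamma ->
  x \in U -> gamma x x = 0 -> b x x = 0.
Proof.
move=> [_ UE] xU xx; have [->|x0] := eqVneq x 0; first by rewrite form0l.
by case: (proj1 (UE _ xU x0) xx).
Qed.

(** If [b x y] were zero, [x + y] and [x - y] would be singular for [b] but not for [gamma], hence
    both in [T]; then so would be their sum, twice [x], although [x] is outside [T]. *)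
Lemma section_form_nonorthogonal U gamma x y : nondegenerate_section U gamma ->
  x \in U -> y \in U -> gamma x x = 0 -> gamma y y = 0 -> gamma x y != 0 -> b x y != 0.
Proof.
move=> nU xU yU xx yy xy; apply/eqP => bxy.
have bxx := section_form_singular nU xU xx; have byy := section_form_singular nU yU yy.
case: nU => _ UE.
have inT z : z \in U -> gamma z z != 0 -> b z z = 0 -> z \in T.
  move=> zU zz bz; have z0 : z != 0 by apply: contraNneq zz => ->; rewrite form0l.
  apply: contrapT => /negP zT; case/negP: zz; apply/eqP/UE => //.
have pT : x + y \in T.
  apply: inT; first exact: rpredD.
    have -> : gamma (x + y) (x + y) = 2%:R * gamma x y.
      by rewrite !formE (formC gamma y x) xx yy; ring.
    by rewrite mulf_neq0.
  by rewrite !formE (formC b y x) bxx byy bxy; ring.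
have mT : x - y \in T.
  apply: inT; first exact: rpredB.
    have -> : gamma (x - y) (x - y) = - (2%:R * gamma x y).
      by rewrite !formE (formC gamma y x) xx yy; ring.
    by rewrite oppr_eq0 mulf_neq0.
  by rewrite !formE (formC b y x) bxx byy bxy; ring.
have x0 : x != 0 by apply: contraNneq xy => ->; rewrite form0l.
have [/negP[]] := proj1 (UE x xU x0) xx.
rewrite -(scalerK two_neq0 x) rpredZ // scaler_nat mulr2n.
have -> : x + x = x + y + (x - y) by rewrite addrACA subrr addr0.
exact: rpredD.
Qed.

(** Splits off two orthogonal hyperbolic pairs that start from a basis of [K], as in a Witt
    decomposition. *)
Lemma ex_hyperbolic_basis U (gamma : {symmetric V}) K : nondegenerate_on gamma U ->
  (K <= U)%VS -> totally_singular gamma K -> \dim K = 2%N ->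
  exists e1 e2 f1 f2, K = (<[e1]> + <[e2]>)%VS /\
    [/\ f1 \in U, f2 \in U, gamma f1 f1 = 0 & gamma f2 f2 = 0] /\
    [/\ gamma e1 f1 = 1, gamma e2 f2 = 1, gamma e1 f2 = 0 & gamma e2 f1 = 0] /\
    gamma f1 f2 = 0.
Proof.
move=> nd KU sK K2; have [|e1 e1K e10] := @ex_neq0 _ _ K; first by rewrite K2.
have [f1 [f1U f11 e1f1]] := hyperbolic_partner two_neq0 nd (subvP KU _ e1K) e10 (sK _ e1K).
have [e2' e2'K e2'e1] : exists2 x, x \in K & x \notin <[e1]>%VS.
  by apply: ex_notin; rewrite dim_vline e10 K2.
have [e2 [e2K e2e1 e2f1]] : exists e2, [/\ e2 \in K, e2 \notin <[e1]>%VS & gamma e2 f1 = 0].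
  exists (e2' - gamma e2' f1 *: e1); split.
  - by rewrite rpredB ?rpredZ.
  - by rewrite rpredBr // rpredZ ?memv_line.
  - by rewrite !formE e1f1; ring.
have e20 : e2 != 0 by apply: contraNneq e2e1 => ->; apply: mem0v.
have [g [gU gg e2g]] := hyperbolic_partner two_neq0 nd (subvP KU _ e2K) e20 (sK _ e2K).
have e12 : gamma e1 e2 = 0 := totally_singular_form two_neq0 sK e1K e2K.
have e11 := sK _ e1K; have e22 := sK _ e2K; have e1U := subvP KU _ e1K.
have e2U := subvP KU _ e2K.
have [h [hU e1h e2h f1h]] : exists h,
    [/\ h \in U, gamma e1 h = 0, gamma e2 h = 1 & gamma f1 h = 0].
  (* Removing the components along the pair [e1], [f1] leaves the product with [e2] at 1, because
     [e2] is orthogonal to both. *)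
  exists (g - gamma g f1 *: e1 - gamma g e1 *: f1); split.
  - by rewrite !rpredB ?rpredZ.
  - by rewrite !formE e11 e1f1 (formC gamma e1 g); ring.
  - by rewrite !formE (formC gamma e2 e1) e12 e2g e2f1; ring.
  - by rewrite !formE f11 (formC gamma f1 e1) e1f1 (formC gamma f1 g); ring.
exists e1, e2, f1, (h - (gamma h h / 2%:R) *: e2); split.
  apply/esym/sub_dim_eq; first by rewrite addline_sub // -memvE.
  by rewrite dim_line2 // K2.
split; last split; last by rewrite !formE (formC gamma f1 e2) f1h e2f1; ring.
  split=> //; first by rewrite rpredB ?rpredZ.
  by rewrite !formE (formC gamma h e2) e22 e2h; field.
by split=> //; rewrite !formE ?e2h ?e1h ?e12 ?e22; ring.
Qed.

(** In a hyperbolic basis starting from [K], the lines through [e1], [f2] and through [e2], [f1]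
    meet [K] in [e1] and in [e2] and are skew to each other. Skew lines span a solid, so they are
    not adjacent. *)
Lemma nondegenerate_section_regulus U gamma K : nondegenerate_section U gamma ->
  lag_line_space K -> (K <= U)%VS -> contains_regulus (section_by U).
Proof.
move=> nU [K2 sK KT] KU; have gK := nondegenerate_section_singular nU KU sK KT.
have [e1 [e2 [f1 [f2 [KE [[f1U f2U f11 f22] [[ef1 ef2 e1f2 e2f1] f12]]]]]]] :=
  ex_hyperbolic_basis (proj1 nU) KU gK K2.
have e1K : e1 \in K by rewrite KE memv_line2l.
have e2K : e2 \in K by rewrite KE memv_addline.
have e1U := subvP KU _ e1K; have e2U := subvP KU _ e2K.
have e11 := gK _ e1K; have e22 := gK _ e2K.
have e12 : gamma e1 e2 = 0 := totally_singular_form two_neq0 gK e1K e2K.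
have n1 : gamma e1 f1 != 0 by rewrite ef1 oner_neq0.
have n2 : gamma e2 f2 != 0 by rewrite ef2 oner_neq0.
have e10 : e1 != 0 by apply: contraNneq n1 => ->; rewrite form0l.
have e20 : e2 != 0 by apply: contraNneq n2 => ->; rewrite form0l.
(* The hyperbolic basis is found for [gamma], while adjacency is about [b]; singularity and
   orthogonality of singular vectors are carried over. *)
have bsing x : x \in U -> gamma x x = 0 -> b x x = 0 := section_form_singular nU.
have borth x y : x \in U -> y \in U -> gamma x x = 0 -> gamma y y = 0 ->
    gamma x y = 0 -> b x y = 0.
  move=> xU yU xx yy xy; apply: polarization; rewrite ?bsing ?rpredD //.
  by rewrite !formE (formC gamma y x) xx yy xy !addr0.
have a1 : adjacent (section_by K) (section_by (<[e1]> + <[f2]>)).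
  rewrite KE; apply: adjacent_concurrent => //;
    by [apply: bsing | apply: borth | apply: (section_form_nonorthogonal nU)].
have a2 : adjacent (section_by K) (section_by (<[e2]> + <[f1]>)).
  have e21 : gamma e2 e1 = 0 by rewrite formC.
  rewrite KE addvC; apply: adjacent_concurrent => //;
    by [apply: bsing | apply: borth | apply: (section_form_nonorthogonal nU)].
have line x y : x \in U -> y \in U -> gamma x x = 0 -> gamma y y = 0 ->
    gamma x y = 0 -> x != 0 -> y \notin <[x]>%VS -> lag_line_space (<[x]> + <[y]>).
  move=> xU yU xx yy xy x0 yx; split; first exact: dim_line2.
    by apply: totally_singular_line2; rewrite ?bsing ?borth.
  apply/negP => /subvP/(_ x (memv_line2l _ _)).
  by case: (proj1 (proj2 nU _ xU x0) xx) => /negP.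
have l1 : lag_line_space (<[e1]> + <[f2]>).
  apply: line => //; apply: contra n2 => /vlineP[c ->].
  by rewrite formZr formC e12 mulr0.
have l2 : lag_line_space (<[e2]> + <[f1]>).
  apply: line => //; apply: contra n1 => /vlineP[c ->].
  by rewrite formZr e12 mulr0.
have disj : ((<[e1]> + <[f2]>) :&: (<[e2]> + <[f1]>) = 0)%VS.
  apply/eqP; rewrite -subv0; apply/subvP=> w; rewrite memv_cap memv0 => /andP[].
  case/memv_line2P=> a [c wE] /memv_line2P[a' [c' wE']].
  have a0 : a = 0.
    have : gamma w f1 = a by rewrite wE !formE ef1 (formC gamma f2 f1) f12; ring.
    by rewrite wE' !formE e2f1 f11 => <-; ring.
  have c0 : c = 0.
    have : gamma w e2 = c by rewrite wE !formE e12 (formC gamma f2 e2) ef2; ring.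
    by rewrite wE' !formE e22 (formC gamma f1 e2) e2f1 => <-; ring.
  by rewrite wE a0 c0 !scale0r addr0.
have d4 : \dim ((<[e1]> + <[f2]>) + (<[e2]> + <[f1]>)) = 4%N.
  by rewrite dimv_disjoint_sum //; case: l1 l2 => [-> _ _] [-> _ _].
have wp1I L : lag_line_space L -> wp1 T Q (section_by L).
  by move=> lL; right; apply/lag_linesP; exists L.
exists (section_by K), (section_by (<[e1]> + <[f2]>)), (section_by (<[e2]> + <[f1]>)).
split; [|split]; split=> //.
- exact: wp1I.
- exact: wp1I.
- exact: wp1I.
- exact: sub_section_by.
- by apply/sub_section_by/addline_sub; rewrite -?memvE.
- by apply/sub_section_by/addline_sub; rewrite -?memvE.
- move/section_by_inj => /(_ (lag_line_spanned l1) (lag_line_spanned l2)) E.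
  by move: disj; rewrite E capvv => E0; case: l2; rewrite E0 dimv0.
- case/(adjacentP (wp1I _ l1) (wp1I _ l2)) => L1 [L2 [[m1 E1] [m2 E2] d3 _]].
  move: d3; rewrite -(section_by_inj (lag_line_spanned l1) (lag_line_spanned m1) E1).
  by rewrite -(section_by_inj (lag_line_spanned l2) (lag_line_spanned m2) E2) d4.
Qed.

Lemma adjacent_not_plane U X1 X2 : \dim U = 3%N -> totally_singular b U ->
  wp1 T Q X1 -> wp1 T Q X2 -> X1 `<=` section_by U -> X2 `<=` section_by U ->
  ~ adjacent X1 X2.
Proof.
move=> U3 sU w1 w2 X1U X2U /(adjacentP w1 w2)[K1 [K2 [[l1 E1] [l2 E2] d3 ns]]].
apply: ns; apply: totally_singularS sU; rewrite subv_add.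
apply/andP; split.
  by apply/(spanned_subP _ (lag_line_spanned l1)); rewrite -E1.
by apply/(spanned_subP _ (lag_line_spanned l2)); rewrite -E2.
Qed.

Lemma adjacent_line X1 X2 U : wp1 T Q X1 -> wp1 T Q X2 -> adjacent X1 X2 ->
  X1 `<=` section_by U -> exists K, [/\ lag_line_space K, X1 = section_by K & (K <= U)%VS].
Proof.
move=> w1 w2 /(adjacentP w1 w2)[K1 [K2 [[l1 E1] _ _ _]]] X1U; exists K1; split=> //.
by apply/(spanned_subP _ (lag_line_spanned l1)); rewrite -E1.
Qed.

Lemma adjacent_sym X1 X2 : adjacent X1 X2 -> adjacent X2 X1.
Proof.
move=> [X12 [Y1 [Y2 [w1 w2 Y12 [s11 s21] [s12 s22]]]]]; split; first by move/esym.
by exists Y1, Y2; split.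
Qed.

(** Being adjacent to [X] forces [X1] and [X2] to be lines, and any two distinct lines of a cone are
    adjacent. *)
Lemma cone_space_no_regulus U v : \dim U = 4%N -> cone_space U v ->
  ~ contains_regulus (section_by U).
Proof.
move=> U4 cU [X [X1 [X2 [[w w1 w2] [[XU X1U X2U] [a1 a2 X12 na]]]]]]; apply: na.
have [K1 [l1 E1 K1U]] := adjacent_line w1 w (adjacent_sym a1) X1U.
have [K2 [l2 E2 K2U]] := adjacent_line w2 w (adjacent_sym a2) X2U.
rewrite E1 E2 in X12 *; exact: (cone_space_lines_adjacent U4 cU).
Qed.

Lemma contains_regulus_nondegenerate Y : wp2 T Q Y -> contains_regulus Y ->
  exists U gamma, nondegenerate_section U gamma /\ Y = section_by U.
Proof.
case/wp2P=> {Y} U.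
- move=> U3 sU [X [X1 [X2 [[w w1 w2] [[XU X1U X2U] [a1 _ _ _]]]]]].
  by case: (adjacent_not_plane U3 sU w w1 XU X1U a1).
- by move=> v U4 cU _ /(cone_space_no_regulus U4 cU).
- by move=> v U4 cU _ /(cone_space_no_regulus U4 cU).
- by move=> gamma _ nU _; exists U, gamma.
Qed.

(** * Projective lines and projective cones in terms of adjacency *)

(** The clause about [X'] rules out the cycles of the block: only lines are adjacent to anything.
    For the forward direction a hyperbolic frame is built around two generators of the line. *)
Lemma projective_lines_regulus X : wp1 T Q X -> projective_lines T Q X <->
  exists Y, [/\ wp2 T Q Y, X `<=` Y, contains_regulus Y &
    exists X', wp1 T Q X' /\ adjacent X X'].
Proof.
move=> wX; split; last first.
  case=> Y [wY XY /(contains_regulus_nondegenerate wY)[U [gamma [nU YE]]] [X' [wX' aX]]].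
  rewrite YE in XY; have [K [lK XE KU]] := adjacent_line wX wX' aX XY.
  apply/projective_linesP; exists K; split=> //.
  by case: lK => _ sK KT; apply: (nondegenerate_section_projective nU KU).
case/projective_linesP=> K [lK KT ->]; have [K2 sK _] := lK.
have [|v vK v0] := @ex_neq0 _ _ K; first by rewrite K2.
have notT x : x \in K -> x != 0 -> x \notin T.
  by move=> xK; apply: contra => xT; rewrite -memv0 -KT memv_cap xK.
have vT := notT _ vK v0; have [x1 x1v KE] := dim2_gen K2 vK v0.
have x1K : x1 \in K by rewrite KE memv_addline.
have ex_nonorth x : x \notin T -> exists y, b x y != 0.
  move=> xT; apply: contrapT => ny; case/negP: xT; apply/radicalP => y.
  by apply: contrapT => /eqP xy; apply: ny; exists y.
have [z vz] := ex_nonorth v vT.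
have vv := sK _ vK; have x11 := sK _ x1K.
have vx1 : b v x1 = 0 := totally_singular_form two_neq0 sK vK x1K.
(* [x1 - c v] is chosen orthogonal to [z] *)
have [y [vy x1y]] : exists y, b v y = 0 /\ b x1 y != 0.
  have [|y' xy'] := ex_nonorth (x1 - (b x1 z / b v z) *: v).
    apply: notT; first by rewrite rpredB ?rpredZ.
    by apply: contraNneq x1v => /eqP; rewrite subr_eq0 => /eqP ->; rewrite rpredZ ?memv_line.
  exists (y' - (b v y' / b v z) *: z); split; first by rewrite !formE; field.
  apply: contra xy' => /eqP xy; apply/eqP; rewrite -[RHS]xy !formE.
  by field.
(* A shift of [y] along the singular vector [x1] makes it singular without changing its products
   with [v] and [x1]. *)
have [x2 [vx2 x22 x12]] : exists x2, [/\ b v x2 = 0, b x2 x2 = 0 & b x1 x2 != 0].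
  exists (y - (b y y / (2%:R * b x1 y)) *: x1); split.
  - by rewrite !formE vy vx1 mulr0 subr0.
  - by rewrite !formE (formC b y x1) x11; field; rewrite two_neq0 x1y.
  - by rewrite !formE x11 mulr0 subr0.
have [z' zP] := ex_hyperbolic_frame vT vv x11 x22 vx1 vx2 x12.
have [U4 nd] := hyperbolic_frame_nondegenerate zP.
set U := (_ + <[z']>)%VS in U4 nd.
have KU : (K <= U)%VS by rewrite KE /U -!addvA addvS // addvSl.
exists (section_by U); split.
- by right; apply: (minkowski_planeI U4 nd KU).
- exact: sub_section_by.
- exact: (nondegenerate_section_regulus (nondegenerate_on_section nd) lK).
exists (section_by (<[v]> + <[x2]>)); split; last first.
  by rewrite KE; apply: adjacent_concurrent.
right; apply/lag_linesP; exists (<[v]> + <[x2]>)%VS => //; split.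
- apply: dim_line2 => //; apply: contra x12 => /vlineP[c ->].
  by rewrite formZr formC vx1 mulr0.
- exact: totally_singular_line2.
- by apply: contra vT => /subvP; apply; apply: memv_line2l.
Qed.

(** Among blocks without a regulus, singular planes contain no adjacent pair, and every line of an
    affine cone passes through its apex in [T], so is not projective. A nondegenerate section that
    contains a line has a regulus. *)
Lemma projective_cones_regulus Y : wp2 T Q Y -> projective_cones T Q Y <->
  ~ contains_regulus Y /\ exists X1 X2, [/\ wp1 T Q X1, wp1 T Q X2,
    X1 `<=` Y /\ X2 `<=` Y, adjacent X1 X2 & projective_lines T Q X1].
Proof.
move=> wY; split.
  case/projective_conesP=> U [v [U4 cU vT ->]]; split.
    exact: (cone_space_no_regulus U4 cU).
  have [vU v0 vv] := cone_space_apex cU.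
  have [A [gamma [[A3 AU vA _ nd] [[c [cA c0 cc]] coneE]]]] := cU.
  (* A second point of the base conic, which gives a second generator of the cone. *)
  have [d [dA dd cd]] := hyperbolic_partner two_neq0 nd cA c0 cc.
  have Asing x : x \in A -> gamma x x = 0 -> b x x = 0.
    by move=> xA xx; apply/coneE; [apply: (subvP AU) | exists 0, x; rewrite scale0r add0r].
  have Aorth x : x \in A -> gamma x x = 0 -> b v x = 0.
    move=> xA xx; rewrite formC; apply: (cone_space_orthogonal cU); last exact: Asing.
    exact: (subvP AU).
  have cv : c \notin <[v]>%VS.
    apply: contra vA => /vlineP[a cE].
    have a0 : a != 0 by apply: contraNneq c0 => a0; rewrite cE a0 scale0r.
    by rewrite -(scalerK a0 v) -cE rpredZ.
  have dv : d \notin (<[v]> + <[c]>)%VS.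
    apply/negP => /memv_line2P[a [e dE]]; have [a0|a0] := eqVneq a 0.
      by move/eqP: cd; rewrite dE a0 scale0r add0r formZr cc mulr0 eq_sym oner_eq0.
    case/negP: vA; rewrite -(scalerK a0 v) rpredZ //.
    by rewrite -(addrK (e *: c) (a *: v)) -dE rpredB ?rpredZ.
  have cU' := subvP AU _ cA; have dU' := subvP AU _ dA.
  (* Otherwise [v], [c], [d] would span a singular plane inside the cone. *)
  have bcd : b c d != 0.
    apply/eqP => bcd.
    apply: (@cone_space_no_singular_plane _ _ (<[v]> + <[c]> + <[d]>) U4 cU).
    - by rewrite !addline_sub // -memvE.
    - by rewrite dim_addline // dim_line2.
    apply: totally_singular_addline; last 1 first.
    - by move=> w /memv_line2P[a [e ->]]; rewrite !formE bcd Aorth // !mulr0 addr0.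
    - by apply: totally_singular_line2 => //; [apply: Asing | apply: Aorth].
    exact: Asing.
  have line x : x \in A -> gamma x x = 0 -> x \notin <[v]>%VS ->
      lag_line_space (<[v]> + <[x]>).
    move=> xA xx xv; split; first exact: dim_line2.
      by apply: totally_singular_line2 => //; [apply: Asing | apply: Aorth].
    by apply: contra vT => /subvP; apply; apply: memv_line2l.
  have lc := line c cA cc cv.
  have ld : lag_line_space (<[v]> + <[d]>).
    by apply: line => //; apply: contra dv; apply: (subvP (addvSl _ _)).
  exists (section_by (<[v]> + <[c]>)), (section_by (<[v]> + <[d]>)); split.
  - by right; apply/lag_linesP; exists (<[v]> + <[c]>)%VS.
  - by right; apply/lag_linesP; exists (<[v]> + <[d]>)%VS.
  - by split; apply/sub_section_by/addline_sub; rewrite -?memvE.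
  - by apply: adjacent_concurrent => //; first [apply: Asing | apply: Aorth].
  apply/projective_linesP; exists (<[v]> + <[c]>)%VS; split=> //.
  apply/eqP; rewrite -subv0; apply/subvP=> w; rewrite memv_cap memv0 => /andP[].
  case/memv_line2P=> a [e wE] wT.
  (* The vector [d] is orthogonal to [v] but not to [c], so its product with a radical vector of the
     line isolates the coefficient of [c]. *)
  have e0 : e = 0.
    have /eqP := form_radicall d wT; rewrite wE !formE Aorth // mulr0 add0r mulf_eq0.
    by rewrite (negPf bcd) orbF => /eqP.
  move: wT; rewrite wE e0 scale0r addr0; have [->|a0] := eqVneq a 0; first by rewrite scale0r.
  by rewrite rpredZeq (negPf a0) (negPf vT).
case=> nr [X1 [X2 [w1 w2 [X1Y X2Y] a12 /projective_linesP[K [lK KT X1E]]]]].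
have KU U : X1 `<=` section_by U -> (K <= U)%VS.
  by rewrite X1E => /(spanned_subP _ (lag_line_spanned lK)).
case/wp2P: wY nr X1Y X2Y => {Y} U.
- by move=> U3 sU _ X1U X2U; case: (adjacent_not_plane U3 sU w1 w2 X1U X2U a12).
- move=> v U4 cU vT _ /KU KU' _; have [_ v0 _] := cone_space_apex cU.
  case/negP: v0; case: lK => K2 sK _; rewrite -memv0 -KT memv_cap vT andbT.
  exact: (cone_space_line_apex U4 cU).
- by move=> v U4 cU vT _ _ _; apply/projective_conesP; exists U, v.
- move=> gamma U4 nU nr /KU KU' _; case: nr.
  exact: (nondegenerate_section_regulus nU lK).
Qed.

End LaguerreSpace.

(** * First-order formulas *)

Section Definability.
Context {M : incidence_structure}.
Implicit Types (x : ipoint M) (y : iblock M).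

(** This predicate and the next three match the formulas below connective by connective, so that
    satisfaction reduces to them by computation. *)
Definition adjacent_points x1 x2 : Prop :=
  x1 <> x2 /\ exists y1 y2, y1 <> y2 /\
    (incident x1 y1 /\ incident x2 y1) /\ incident x1 y2 /\ incident x2 y2.

Definition regulus_block y : Prop := exists x x1 x2,
  (incident x y /\ incident x1 y /\ incident x2 y) /\
  (adjacent_points x x1 /\ adjacent_points x x2) /\
  x1 <> x2 /\ ~ adjacent_points x1 x2.

Definition regulus_line x : Prop := exists y,
  incident x y /\ regulus_block y /\ exists x', adjacent_points x x'.

Definition regulus_free_cone y : Prop := ~ regulus_block y /\
  exists x1 x2, (incident x1 y /\ incident x2 y) /\
    adjacent_points x1 x2 /\ regulus_line x1.

(** Variables behave as de Bruijn indices: [None] is the innermost binder of its sort and each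
    [Some] goes one binder out. Quantifying over blocks leaves point variables unshifted, and
    conversely. *)
Definition adjacent_formula X Y (x1 x2 : X) : formula X Y :=
  FAnd (FNot (FEqPoint Y x1 x2)) (FExBlock (FExBlock
    (FAnd (FNot (FEqBlock X (Some None) None))
    (FAnd (FAnd (FInc x1 (Some None)) (FInc x2 (Some None)))
          (FAnd (FInc x1 None) (FInc x2 None)))))).

Definition regulus_formula X Y (y : Y) : formula X Y :=
  FExPoint (FExPoint (FExPoint
    (FAnd (FAnd (FInc (Some (Some None)) y) (FAnd (FInc (Some None) y) (FInc None y)))
    (FAnd (FAnd (adjacent_formula Y (Some (Some None)) (Some None))
                (adjacent_formula Y (Some (Some None)) None))
    (FAnd (FNot (FEqPoint Y (Some None) None))
          (FNot (adjacent_formula Y (Some None) None))))))).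

Definition line_formula X Y (x : X) : formula X Y :=
  FExBlock (FAnd (FInc x None) (FAnd (regulus_formula X None)
    (FExPoint (adjacent_formula (option Y) (Some x) None)))).

Definition cone_formula X Y (y : Y) : formula X Y :=
  FAnd (FNot (regulus_formula X y)) (FExPoint (FExPoint
    (FAnd (FAnd (FInc (Some None) y) (FInc None y))
    (FAnd (adjacent_formula Y (Some None) None)
          (line_formula Y (Some None)))))).

Lemma definable_pointsI (D : set (ipoint M)) :
  (forall x, D x <-> regulus_line x) -> definable_points D.
Proof. by move=> DE; exists (line_formula void tt). Qed.

Lemma definable_blocksI (D : set (iblock M)) :
  (forall y, D y <-> regulus_free_cone y) -> definable_blocks D.
Proof. by move=> DE; exists (cone_formula void tt). Qed.

End Definability.

(** * From subsets of the space to elements of the two sorts *)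

Section Grassmann.
Context {F : fieldType} {V : vectType F} (T : {vspace V}) (Q : set (proj_point V)).
Implicit Types (X : ipoint (grassmann1 T Q)) (Y : iblock (grassmann1 T Q)).

Lemma adjacent_pointsE X1 X2 : adjacent_points X1 X2 <-> adjacent T Q (sval X1) (sval X2).
Proof.
split=> [[X12 [Y1 [Y2 [Y12 [s1 s2]]]]]|[X12 [Y1 [Y2 [w1 w2 Y12 s1 s2]]]]].
  split; first by move/eq_sval.
  by exists (sval Y1), (sval Y2); split=> //; [exact: svalP | exact: svalP | move/eq_sval].
split; first by move/eq_sval.
by exists (exist _ Y1 w1), (exist _ Y2 w2); split=> //; move/eq_sval.
Qed.

Lemma regulus_blockE Y : regulus_block Y <-> contains_regulus T Q (sval Y).
Proof.
split=> [[X [X1 [X2 [[s [s1 s2]] [[a1 a2] [X12 na]]]]]]|].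
  exists (sval X), (sval X1), (sval X2); split; first by split; apply: svalP.
  split=> //; split; [exact/adjacent_pointsE | exact/adjacent_pointsE | |].
    by move/eq_sval.
  by move/adjacent_pointsE.
case=> X [X1 [X2 [[w w1 w2] [[s s1 s2] [a1 a2 X12 na]]]]].
exists (exist _ X w), (exist _ X1 w1), (exist _ X2 w2); split=> //.
split; first by split; apply/adjacent_pointsE.
by split; [move/eq_sval | move/adjacent_pointsE].
Qed.

End Grassmann.

(** * The form of the cone *)

Section Pullback.
Context {F : fieldType} {V : vectType F}.

Definition pullback (f : 'End(V)) (beta : {symmetric V}) (u v : V) := beta (f u) (f v).

Context (f : 'End(V)) (beta : {symmetric V}).

Lemma pullback_is_bilinear : bilinear_for
  (GRing.Scale.Law.clone _ _ ( *%R ) _) (GRing.Scale.Law.clone _ _ (idfun \; *%R ) _)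
  (pullback f beta).
Proof. by split=> [w|w] a u v; rewrite /pullback linearP !formE. Qed.

HB.instance Definition _ := bilinear_isBilinear.Build F V V F
  (GRing.Scale.Law.clone _ _ ( *%R ) _) (GRing.Scale.Law.clone _ _ (idfun \; *%R ) _)
  (pullback f beta) pullback_is_bilinear.

Lemma pullback_is_symmetric u v :
  pullback f beta u v = (-1) ^+ false * idfun (pullback f beta v u).
Proof. by rewrite expr0 mul1r /pullback formC. Qed.

HB.instance Definition _ := @isHermitianSesquilinear.Build F V false idfun
  (pullback f beta) pullback_is_symmetric.

End Pullback.

Section ConeForm.
Context {F : fieldType} {V : vectType F} (T B : {vspace V}) (beta : {symmetric V}).
Hypotheses (TB0 : (T :&: B)%VS = 0%VS) (TB1 : (T + B)%VS = fullv).
Hypothesis beta_nondegenerate : nondegenerate_on beta B.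

(** Pulling [beta] back along the projection onto [B] parallel to [T] gives a form on the whole
    space with radical [T] and the cone as zero set. *)
Definition cone_form : {symmetric V} := pullback (daddv_pi B T) beta.

Lemma cone_formE u v : cone_form u v = beta (daddv_pi B T u) (daddv_pi B T v).
Proof. by []. Qed.

Lemma projection_split u : daddv_pi B T u + daddv_pi T B u = u.
Proof. by apply: daddv_pi_add; [rewrite capvC | rewrite addvC TB1 memvf]. Qed.

Lemma projectionD t y : t \in T -> y \in B -> daddv_pi B T (t + y) = y.
Proof.
move=> tT yB; rewrite linearD /= (daddv_pi_id _ yB) ?(capvC B) //.
have := projection_split t; rewrite (daddv_pi_id TB0 tT) => /(canRL (addrK t)).
by rewrite subrr => ->; rewrite add0r.
Qed.

Lemma cone_form_radicalP u : u \in T <-> forall v, cone_form u v = 0.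
Proof.
split=> [uT v|u0].
  by rewrite cone_formE -[u]addr0 projectionD ?mem0v // form0l.
rewrite -(projection_split u) [daddv_pi B T u]beta_nondegenerate ?memv_pi //.
  by rewrite add0r memv_pi.
move=> v vB; have := u0 v; rewrite cone_formE.
by rewrite (daddv_pi_id _ vB) // capvC.
Qed.

Lemma cone_formP (Q : set (proj_point V)) p : T != 0%VS -> Q !=set0 ->
  Q = [set q | (val q <= B)%VS /\ forall u, u \in val q -> beta u u = 0] ->
  cone T Q p <-> totally_singular cone_form (val p).
Proof.
move=> T0 [y0 Qy0] QE; have [u u0 pu] := point_gen p; split.
  case=> t [y [tT Qy py]] w /(subvP py)/memv_addP[s st [x xy ->]].
  move: Qy; rewrite QE => -[yB ys].
  by rewrite cone_formE projectionD ?(subvP tT) ?(subvP yB) // ys.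
move/(_ u); rewrite pu memv_line => /(_ isT); rewrite cone_formE => uu.
(* A zero component of [u] spans no point, so any point of [T], and below any point of [Q], takes
   its place; this is why both must be nonempty. *)
have [t [tT tu]] : exists t : proj_point V, (val t <= T)%VS /\ daddv_pi T B u \in val t.
  have [->|t0] := eqVneq (daddv_pi T B u) 0.
    have [|x xT x0] := @ex_neq0 _ _ T; first by rewrite lt0n dimv_eq0.
    by have [t tx] := ex_point x0; exists t; rewrite tx -memvE mem0v.
  by have [t tE] := ex_point t0; exists t; rewrite tE -memvE memv_pi memv_line.
have [y [Qy yu]] : exists y, Q y /\ daddv_pi B T u \in val y.
  have [->|x0] := eqVneq (daddv_pi B T u) 0; first by exists y0; rewrite mem0v.
  have [y yE] := ex_point x0; exists y; rewrite QE /= yE -memvE memv_pi memv_line.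
  by split=> //; split=> //; apply: totally_singular_line.
exists t, y; split=> //; rewrite pu -memvE -(projection_split u) addrC.
exact: memv_add.
Qed.

End ConeForm.

Theorem corollary5p5 (F : fieldType) (V : vectType F) (T B : {vspace V})
    (Q : set (proj_point V)) :
  2%N \notin [pchar F] ->
  T <> 0%VS -> B <> 0%VS -> (T :&: B)%VS = 0%VS -> (T + B)%VS = fullv ->
  nondegenerate_quadric B Q -> ruled Q ->
  definable_points
    ([set X | projective_lines T Q (sval X)] : set (ipoint (grassmann1 T Q))) /\
  definable_blocks
    ([set Y | projective_cones T Q (sval Y)] : set (iblock (grassmann1 T Q))).
Proof.
move=> pcharF /eqP T0 _ TB0 TB1 [beta [nd QE]] [K [K2 KQ]].
have two_neq0 : 2%:R != 0 :> F by move: pcharF; rewrite inE /=.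
have [|k kK k0] := @ex_neq0 _ _ K; first by rewrite K2.
have [p pk] := ex_point k0.
have Q0 : Q !=set0 by exists p; apply: KQ; apply/(points_of_line _ pk).
have KB u : u \in K -> u \in B /\ beta u u = 0.
  move=> uK; have [->|u0] := eqVneq u 0; first by rewrite mem0v form0l.
  have [q qu] := ex_point u0.
  have : Q q by apply: KQ; apply/(points_of_line _ qu).
  by rewrite QE /= qu -memvE => -[uB b0]; split=> //; apply: b0; rewrite memv_line.
(* Ruledness enters here: the line on [Q] is totally singular of dimension 2, and a nondegenerate
   form needs twice that dimension. *)
have dimB : (4 <= \dim B)%N.
  have sK : totally_singular beta K by move=> u /KB[].
  have := totally_singular_dim two_neq0 nd sK; rewrite K2; apply.
  by apply/subvP=> u /KB[].
have codim : (\dim T + 4 <= \dim {:V})%N.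
  by rewrite -TB1 dimv_disjoint_sum // leq_add2l.
have coneE q : lag_cone T Q q <-> totally_singular (cone_form T B beta) (val q).
  exact: cone_formP.
have radP := cone_form_radicalP TB0 TB1 nd.
have lineE (X : ipoint (grassmann1 T Q)) :
    projective_lines T Q (sval X) <-> regulus_line X.
  rewrite (projective_lines_regulus two_neq0 coneE radP T0 codim (svalP X)).
  split=> [[Y [wY XY rY [X' [wX' aX]]]]|
           [Y [XY [/regulus_blockE rY [X' /adjacent_pointsE aX]]]]].
    exists (exist _ Y wY); split=> //; split; first exact/regulus_blockE.
    by exists (exist _ X' wX'); apply/adjacent_pointsE.
  exists (sval Y); split=> //; first exact: svalP.
  by exists (sval X'); split=> //; apply: svalP.
split; first exact: definable_pointsI.
apply: definable_blocksI => Y /=.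
rewrite (projective_cones_regulus two_neq0 coneE radP T0 codim (svalP Y)).
rewrite /regulus_free_cone regulus_blockE.
split=> -[nr [X1 [X2 H]]]; split=> //.
  case: H => w1 w2 [s1 s2] a pl.
  exists (exist _ X1 w1), (exist _ X2 w2); split=> //; split; first exact/adjacent_pointsE.
  exact/lineE.
case: H => [[s1 s2] [/adjacent_pointsE a /lineE pl]].
by exists (sval X1), (sval X2); split=> //; apply: svalP.
Qed.
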